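(* Let $p\ge 2$ be an integer and $q=e^{\pi i/p}$. The set $\{e_s^{+},e_s^{-}\mid 1\le s\le p\}$ is a basic set of primitive idempotents of $\overline{U}_q$.
   Context: $\overline{U}_q=\overline{U}_qsl_2(\mathbb{C})$ is the associative unital $\mathbb{C}$-algebra generated by $E,F,K$ with relations $E^p=F^p=0$, $K^{2p}=1$, $KEK^{-1}=q^2E$, $KFK^{-1}=q^{-2}F$, $EF-FE=\frac{K-K^{-1}}{q-q^{-1}}$. Put $[n]=\frac{q^n-q^{-n}}{q-q^{-1}}$. In all formulas with $\pm,\mp$, upper signs go together and lower signs go together; empty products are $1$, empty sums are $0$. For $1\le s\le p$ put $v_s^{\pm}=\sum_{\ell=0}^{2p-1}(\pm q^{-(s-1)})^{\ell}K^{\ell}$ and $a_0^{\pm}(s)=E^{p-1}F^{p-1}v_s^{\pm}$. For $1\le s\le p-1$ put $$\alpha_n^{\pm}(s)=\prod_{k=p-s-(n-1)}^{p-s-1}(\mp[k][p-s-k]),\qquad b_0^{\pm}(s)=\sum_{n=1}^{p-s}\alpha_n^{\pm}(s)E^{p-1-n}F^{p-1-n}v_s^{\pm},$$ $$\gamma^{\pm}(s)=2p\prod_{m=1}^{p-s-1}(\mp[m][p-s-m])\prod_{i=1}^{s-1}(\pm[i][s-i]),$$ $$\delta^{\pm}(s)=2p\prod_{m=1}^{p-s-1}(\mp[m][p-s-m])\sum_{j=1}^{s-1}\prod_{1\le k\le s-1,\,k\ne j}(\pm[k][s-k])+2p\prod_{i=1}^{s-1}(\pm[i][s-i])\sum_{n=1}^{p-s-1}\prod_{1\le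 k\le p-s-1,\,k\ne n}(\mp[k][p-s-k]).$$ Then $$e_s^{\pm}=\frac{1}{\gamma^{\pm}(s)}\Big(b_0^{\pm}(s)-\frac{\delta^{\pm}(s)}{\gamma^{\pm}(s)}a_0^{\pm}(s)\Big)\ (1\le s\le p-1),\qquad e_p^{\pm}=\frac{1}{2p\prod_{i=1}^{p-1}(\pm[i][p-i])}a_0^{\pm}(p).$$ Basic set of primitive idempotents: let $A$ be a finite-dimensional associative unital $\mathbb{C}$-algebra and $1=\sum_{i=1}^{n}\sum_{j=1}^{n_i}e_{ij}$ a decomposition of the unity into (mutually orthogonal) primitive idempotents with $Ae_{ij}\cong Ae_{ik}$ for all $i,j,k$ and $Ae_{ij}\not\cong Ae_{kl}$ for $i\ne k$. Choosing for each $i$ one $e_i=e_{ij}$ for some $1\le j\le n_i$, the set $\{e_i\mid 1\le i\le n\}$ is called a basic set of primitive idempotents of $A$. *)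

(* Defs.v *)
From HB Require Import structures.
From mathcomp Require Import all_boot all_order all_algebra.
From mathcomp Require Import boolp classical_sets reals trigo.
From mathcomp Require Import complex ring_quotient generic_quotient.
(* The notations of [monalg] clash with those of MathComp-Analysis. *)
From mathcomp Require finmap monalg.
Import -(notations) monalg.

Set Implicit Arguments.
Unset Strict Implicit.
Unset Printing Implicit Defensive.

Import Order.TTheory GRing.Theory Num.Theory.

Local Open Scope classical_set_scope.
Local Open Scope quotient_scope.
Local Open Scope complex_scope.
Local Open Scope ring_scope.

Section GeneratedIdeal.
Variables (A : nzRingType) (S : set A).

Definition two_sided_ideal (J : set A) : Prop :=
  [/\ J 0, forall x y, J x -> J y -> J (x - y)
    & forall a b x, J x -> J (a * x * b)].

Definition gen_ideal : {pred A} :=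
  fun x => `[< forall J, two_sided_ideal J -> S `<=` J -> J x >].

Lemma gen_idealP x :
  reflect (forall J, two_sided_ideal J -> S `<=` J -> J x) (x \in gen_ideal).
Proof. exact: asboolP. Qed.

Fact gen_ideal_zmod_closed : zmod_closed gen_ideal.
Proof.
split=> [|x y /gen_idealP Ix /gen_idealP Iy]; apply/gen_idealP => J HJ SJ.
  by case: (HJ).
by case: (HJ) => _ JB _; apply: JB; [apply: Ix | apply: Iy].
Qed.

HB.instance Definition _ := GRing.isZmodClosed.Build A gen_ideal
  gen_ideal_zmod_closed.

Lemma gen_idealM a b x : x \in gen_ideal -> a * x * b \in gen_ideal.
Proof.
move=> /gen_idealP Ix; apply/gen_idealP => J HJ SJ.
by case: (HJ) => _ _ JM; apply: JM; apply: Ix.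
Qed.

Lemma sub_gen_ideal x : S x -> x \in gen_ideal.
Proof. by move=> Sx; apply/gen_idealP => J _; apply. Qed.

End GeneratedIdeal.

(* MathComp's ring structure on quotients by ideals is restricted to          *)
(* commutative rings: only its additive part is reused.  The properness       *)
(* hypothesis is there because an [nzRingType] satisfies 1 != 0.              *)
Definition quot_alg (F : comNzRingType) (A : algType F) (S : set A)
  of 1 \notin gen_ideal S := Quotient.quot (gen_ideal S).

Section QuotientAlgebra.
Variables (F : comNzRingType) (A : algType F) (S : set A).
Hypothesis S1 : 1 \notin gen_ideal S.

Local Notation I := (gen_ideal S).
Local Notation Q := (quot_alg S1).

HB.instance Definition _ := GRing.Zmodule.on Q.

Definition quot_proj (x : A) : Q := \pi_(Quotient.quot I) x.
Definition quot_repr (x : Q) : A := repr (x : Quotient.quot I).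

Local Notation pr := quot_proj.
Local Notation rp := quot_repr.

Lemma quot_reprK x : pr (rp x) = x.
Proof. exact: reprK. Qed.

Lemma quot_projP x y : reflect (pr x = pr y) (x - y \in I).
Proof. by rewrite Quotient.idealrBE; apply: eqP. Qed.

Fact quot_proj_zmod_morphism : zmod_morphism pr.
Proof. exact: (raddfB (\pi_(Quotient.quot I))). Qed.

HB.instance Definition _ := GRing.isZmodMorphism.Build A Q pr
  quot_proj_zmod_morphism.

Definition quot_one : Q := pr 1.
Definition quot_mul (x y : Q) : Q := pr (rp x * rp y).
Definition quot_scale (c : F) (x : Q) : Q := pr (c *: rp x).

Fact quot_projM x y : pr (x * y) = quot_mul (pr x) (pr y).
Proof.
apply/quot_projP.
have /quot_projP hx : pr x = pr (rp (pr x)) by rewrite quot_reprK.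
have /quot_projP hy : pr y = pr (rp (pr y)) by rewrite quot_reprK.
have -> : x * y - rp (pr x) * rp (pr y)
    = 1 * (x - rp (pr x)) * y + rp (pr x) * (y - rp (pr y)) * 1.
  by rewrite mul1r mulr1 mulrBl mulrBr addrA subrK.
by rewrite rpredD ?gen_idealM.
Qed.

Fact quot_projZ c x : pr (c *: x) = quot_scale c (pr x).
Proof.
apply/quot_projP.
have /quot_projP hx : pr x = pr (rp (pr x)) by rewrite quot_reprK.
have -> : c *: x - c *: rp (pr x) = (c *: 1) * (x - rp (pr x)) * 1.
  by rewrite mulr1 -scalerAl mul1r scalerBr.
exact: gen_idealM.
Qed.

Fact quot_mulA : associative quot_mul.
Proof.
move=> x y z; rewrite -[x]quot_reprK -[y]quot_reprK -[z]quot_reprK.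
by rewrite -!quot_projM mulrA.
Qed.

Fact quot_mul1q : left_id quot_one quot_mul.
Proof. by move=> x; rewrite -[x]quot_reprK -quot_projM mul1r. Qed.

Fact quot_mulq1 : right_id quot_one quot_mul.
Proof. by move=> x; rewrite -[x]quot_reprK -quot_projM mulr1. Qed.

Fact quot_mulDl : left_distributive quot_mul +%R.
Proof.
move=> x y z; rewrite -[x]quot_reprK -[y]quot_reprK -[z]quot_reprK.
by rewrite -!(raddfD, quot_projM) mulrDl.
Qed.

Fact quot_mulDr : right_distributive quot_mul +%R.
Proof.
move=> x y z; rewrite -[x]quot_reprK -[y]quot_reprK -[z]quot_reprK.
by rewrite -!(raddfD, quot_projM) mulrDr.
Qed.

Fact quot_one_neq0 : quot_one != 0.
Proof.
apply/eqP => h; move: S1; rewrite -[1]subr0.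
by move/negP; apply; apply/quot_projP; rewrite raddf0.
Qed.

HB.instance Definition _ := GRing.Zmodule_isNzRing.Build Q
  quot_mulA quot_mul1q quot_mulq1 quot_mulDl quot_mulDr quot_one_neq0.

Fact quot_scaleA a b x : quot_scale a (quot_scale b x) = quot_scale (a * b) x.
Proof. by rewrite -[x]quot_reprK -!quot_projZ scalerA. Qed.

Fact quot_scale1 : left_id 1 quot_scale.
Proof. by move=> x; rewrite -[x]quot_reprK -quot_projZ scale1r. Qed.

Fact quot_scaleDr : right_distributive quot_scale +%R.
Proof.
move=> a x y; rewrite -[x]quot_reprK -[y]quot_reprK.
by rewrite -raddfD -!quot_projZ -raddfD scalerDr.
Qed.

Fact quot_scaleDl x : {morph quot_scale^~ x : a b / a + b}.
Proof.
by move=> a b; rewrite -[x]quot_reprK -!quot_projZ -raddfD scalerDl.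
Qed.

HB.instance Definition _ := GRing.Zmodule_isLmodule.Build F Q
  quot_scaleA quot_scale1 quot_scaleDr quot_scaleDl.

Fact quot_scaleAl (a : F) (x y : Q) : a *: (x * y) = (a *: x) * y.
Proof.
rewrite -[LHS]/(quot_scale a (quot_mul x y)).
rewrite -[RHS]/(quot_mul (quot_scale a x) y) -[x]quot_reprK -[y]quot_reprK.
by rewrite -!(quot_projM, quot_projZ) scalerAl.
Qed.

HB.instance Definition _ := GRing.Lmodule_isLalgebra.Build F Q quot_scaleAl.

Fact quot_scaleAr (a : F) (x y : Q) : a *: (x * y) = x * (a *: y).
Proof.
rewrite -[LHS]/(quot_scale a (quot_mul x y)).
rewrite -[RHS]/(quot_mul x (quot_scale a y)) -[x]quot_reprK -[y]quot_reprK.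
by rewrite -!(quot_projM, quot_projZ) scalerAr.
Qed.

HB.instance Definition _ := GRing.Lalgebra_isAlgebra.Build F Q quot_scaleAr.

Fact quot_proj_monoid_morphism : monoid_morphism pr.
Proof. by split=> // x y; rewrite quot_projM. Qed.

HB.instance Definition _ := GRing.isMonoidMorphism.Build A Q pr
  quot_proj_monoid_morphism.

Fact quot_proj_scalable : scalable pr.
Proof. by move=> c x; rewrite quot_projZ. Qed.

HB.instance Definition _ := GRing.isScalable.Build F A Q *:%R pr
  quot_proj_scalable.

End QuotientAlgebra.

(* On [malg M F] itself, the [algType] structure is reserved by [monalg] to   *)
(* commutative monoids.                                                       *)
Section MonoidAlgebra.
Variables (F : comNzRingType) (M : monomType).

Definition monoid_alg := malg M F.

Fact monoid_alg_scaleAr (a : F) (x y : malg M F) : a *: (x * y) = x * (a *: y).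
Proof.
apply/malgP => m; rewrite mcoeffZ mcoeffMl.
rewrite (mcoeffMlw _ (finmap.fsubset_refl _) (msuppZ_le a y)) mulr_sumr.
apply: eq_bigr => k _; rewrite mulr_sumr; apply: eq_bigr => l _.
by rewrite mcoeffZ mulrnAr mulrCA.
Qed.

HB.instance Definition _ := GRing.Lalgebra.on monoid_alg.
HB.instance Definition _ := GRing.Lalgebra_isAlgebra.Build F monoid_alg
  monoid_alg_scaleAr.

End MonoidAlgebra.

Definition free_monoid (I : choiceType) : monomType := fmonom I.

(* Noncommutative polynomials with variables in I. *)
Definition free_alg (F : comNzRingType) (I : choiceType) : algType F :=
  monoid_alg F (free_monoid I).

Definition free_gen (F : comNzRingType) (I : choiceType) (i : I) :
  free_alg F I := mkmalgU (fmu i) 1.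

Section LeftModules.
Variables (A : nzRingType) (e : A).

Definition left_ideal_pred : {pred A^o} :=
  fun x : A => `[< exists a : A, x = a * e >].

Fact left_ideal_submod_closed : submod_closed left_ideal_pred.
Proof.
split=> [|a x y /asboolP[u ->] /asboolP[v ->]]; apply/asboolP.
  by exists 0; rewrite mul0r.
by exists (a * u + v); rewrite mulrDl -mulrA.
Qed.

HB.instance Definition _ := GRing.isSubmodClosed.Build A A^o left_ideal_pred
  left_ideal_submod_closed.

(* The left A-module A e; [A^o] is A as a left module over itself. *)
Definition left_ideal := {x : A^o | left_ideal_pred x}.

HB.instance Definition _ := [isSub of left_ideal for @sval _ _].
HB.instance Definition _ := [Choice of left_ideal by <:].
HB.instance Definition _ := [SubChoice_isSubLmodule of left_ideal by <:].

End LeftModules.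

Definition lmod_isomorphic (A : nzRingType) (U V : lmodType A) : Prop :=
  exists f : {linear U -> V}, bijective f.

Definition is_idempotent (A : nzRingType) (e : A) : Prop := e * e = e.

Definition orthogonal_elts (A : nzRingType) (e f : A) : Prop :=
  e * f = 0 /\ f * e = 0.

Definition primitive_idempotent (A : nzRingType) (e : A) : Prop :=
  [/\ is_idempotent e, e <> 0
    & forall f g : A,
        is_idempotent f -> is_idempotent g -> orthogonal_elts f g ->
        e = f + g -> f = 0 \/ g = 0].

Definition finite_dimensional (F : fieldType) (A : algType F) : Prop :=
  exists (n : nat) (b : 'I_n -> A),
    forall x, exists c : 'I_n -> F, x = \sum_(i < n) c i *: b i.

(* The indices j range over 'I_(m i), and [c] is the choice of one j for     *)
(* each i.                                                                   *)
Definition is_basic_set (F : fieldType) (A : algType F) (S : set A) : Prop :=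
  finite_dimensional A /\
  exists (n : nat) (m : 'I_n -> nat) (e : forall i : 'I_n, 'I_(m i) -> A)
         (c : forall i : 'I_n, 'I_(m i)),
    [/\ 1 = \sum_(i < n) \sum_(j < m i) e i j,
        forall i j, primitive_idempotent (e i j),
        forall i (j : 'I_(m i)) k (l : 'I_(m k)),
          (i != k) || (j != l :> nat) -> orthogonal_elts (e i j) (e k l),
        (forall i j k,
           lmod_isomorphic (left_ideal (e i j)) (left_ideal (e i k))) /\
        (forall i (j : 'I_(m i)) k (l : 'I_(m k)), i != k ->
           ~ lmod_isomorphic (left_ideal (e i j)) (left_ideal (e k l)))
      & S = [set x | exists i, x = e i (c i)]].

Section Formulas.
Variables (C : fieldType) (q : C) (p : nat).

Definition qint (n : nat) : C := (q ^+ n - q ^- n) / (q - q^-1).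

Local Notation "[ n ]_q" := (qint n) (at level 0, format "[ n ]_q").

(* The formulas with signs are parametrized by a boolean [b], which is        *)
(* [false] for the upper signs: +- is [pm b] and -+ is [- pm b].              *)
Definition pm (b : bool) : C := (-1) ^+ b.

Definition alpha_ (b : bool) (s n : nat) : C :=
  \prod_(p - s - n.-1 <= k < p - s) (- pm b * [k]_q * [p - s - k]_q).

Definition gamma_ (b : bool) (s : nat) : C :=
  (2 * p)%:R
  * \prod_(1 <= k < p - s) (- pm b * [k]_q * [p - s - k]_q)
  * \prod_(1 <= k < s) (pm b * [k]_q * [s - k]_q).

Definition delta_ (b : bool) (s : nat) : C :=
  (2 * p)%:R
  * \prod_(1 <= k < p - s) (- pm b * [k]_q * [p - s - k]_q)
  * (\sum_(1 <= j < s)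
       \prod_(1 <= k < s | k != j) (pm b * [k]_q * [s - k]_q))
  + (2 * p)%:R
  * \prod_(1 <= k < s) (pm b * [k]_q * [s - k]_q)
  * (\sum_(1 <= n < p - s)
       \prod_(1 <= k < p - s | k != n) (- pm b * [k]_q * [p - s - k]_q)).

Variables (A : algType C) (E F K : A).

(* Here K^-1 is K ^ (2 p - 1), because of the relation K ^ (2 p) = 1. *)
Definition Uq_relations : set A :=
  [set` [:: E ^+ p; F ^+ p; K ^+ (2 * p) - 1;
            K * E * K ^+ (2 * p).-1 - q ^+ 2 *: E;
            K * F * K ^+ (2 * p).-1 - q ^- 2 *: F;
            E * F - F * E - (q - q^-1)^-1 *: (K - K ^+ (2 * p).-1)]].

Definition v_ (b : bool) (s : nat) : A :=
  \sum_(0 <= l < 2 * p) (pm b * q ^- s.-1) ^+ l *: K ^+ l.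

Definition a0_ (b : bool) (s : nat) : A := E ^+ p.-1 * F ^+ p.-1 * v_ b s.

Definition b0_ (b : bool) (s : nat) : A :=
  \sum_(1 <= n < (p - s).+1)
    alpha_ b s n *: (E ^+ (p.-1 - n) * F ^+ (p.-1 - n) * v_ b s).

Definition e_ (b : bool) (s : nat) : A :=
  if s == p then
    ((2 * p)%:R * \prod_(1 <= k < p) (pm b * [k]_q * [p - k]_q))^-1 *: a0_ b p
  else
    (gamma_ b s)^-1 *: (b0_ b s - (delta_ b s / gamma_ b s) *: a0_ b s).

(* The counit (E, F |-> 0, K |-> 1) respects the relations. *)
Fact Uq_relations_counit (ev : {rmorphism A -> C}) : (1 < p)%N ->
  (forall c x, ev (c *: x) = c * ev x) -> ev E = 0 -> ev F = 0 -> ev K = 1 ->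
  forall x, Uq_relations x -> ev x = 0.
Proof.
move=> p1 evZ evE evF evK x.
rewrite /Uq_relations /= !inE => /or4P[|||/or3P[]] /eqP->.
- by rewrite rmorphXn evE expr0n gtn_eqF// ltnW.
- by rewrite rmorphXn evF expr0n gtn_eqF// ltnW.
- by rewrite rmorphB rmorphXn evK rmorph1 expr1n subrr.
- by rewrite rmorphB !rmorphM evZ evE mulr0 mul0r mulr0 subrr.
- by rewrite rmorphB !rmorphM evZ evF mulr0 mul0r mulr0 subrr.
- rewrite !rmorphB !rmorphM evZ evE mul0r mulr0 subrr rmorphB rmorphXn evK.
  by rewrite expr1n subrr mulr0 subrr.
Qed.

End Formulas.

Section RestrictedQuantumGroup.
Variables (C : fieldType) (q : C) (p : nat).

Local Notation gen i := (free_gen C (inord i : 'I_3)).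

Definition Uq_free_relations : set (free_alg C 'I_3) :=
  Uq_relations q p (gen 0) (gen 1) (gen 2).

Let h (m : free_monoid 'I_3) : C := \prod_(i <- m) (i == inord 2)%:R.

Fact counit_mmorphism : mmorphism h.
Proof.
by split=> [x y|]; rewrite /h ?fmM ?big_cat// fm1 big_nil.
Qed.

HB.instance Definition _ := isMultiplicative.Build (free_monoid 'I_3) C h
  counit_mmorphism.

Fact Uq_relations_proper : (1 < p)%N -> 1 \notin gen_ideal Uq_free_relations.
Proof.
move=> p1; apply/negP => /gen_idealP.
have [ev [evg evZ]] : exists ev : {rmorphism free_alg C 'I_3 -> C},
    (forall i, ev (free_gen C i) = (i == inord 2)%:R)
    /\ (forall c x, ev (c *: x) = c * ev x).
  exists (mmap idfun h : {rmorphism _ -> _}); split=> [i|c x]; last exact: mmapZ.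
  by rewrite /= mmapU mul1r /h fmU big_seq1.
move/(_ [set x | ev x = 0]) => H.
suff : ev 1 = 0 by rewrite rmorph1 => /eqP; rewrite oner_eq0.
have neq2 k : (k < 2)%N -> (inord k == inord 2 :> 'I_3) = false.
  move=> k2; apply/negP => /eqP/(congr1 val); rewrite /= !inordK//.
    by move=> kE; rewrite kE in k2.
  by rewrite (ltn_trans k2).
apply: H => /=.
  split=> [|x y /= ex ey|a b x /= ex]; rewrite /= ?rmorph0//.
    by rewrite rmorphB ex ey subr0.
  by rewrite !rmorphM ex mulr0 mul0r.
move=> x; apply: Uq_relations_counit => //; first by rewrite evg neq2.
  by rewrite evg neq2.
by rewrite evg eqxx.
Qed.

Variable p2 : (2 <= p)%N.

Definition Uq : algType C := quot_alg (Uq_relations_proper p2).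

Definition Uq_E : Uq := quot_proj _ (gen 0).
Definition Uq_F : Uq := quot_proj _ (gen 1).
Definition Uq_K : Uq := quot_proj _ (gen 2).

End RestrictedQuantumGroup.

(* exp (pi i / p) *)
Definition q_root (R : realType) (p : nat) : R[i] :=
  cos (trigo.pi / p%:R) +i* sin (trigo.pi / p%:R).

(* Main.v *)
Require Import Defs.
From HB Require Import structures.
From mathcomp Require Import all_boot all_order all_algebra.
From mathcomp Require Import ring zify.
From mathcomp Require Import boolp classical_sets reals complex trigo.
From mathcomp Require finmap monalg.
Import -(notations) monalg.

Set Implicit Arguments.
Unset Strict Implicit.
Unset Printing Implicit Defensive.

Import Order.TTheory GRing.Theory Num.Theory.

Local Open Scope classical_set_scope.
Local Open Scope ring_scope.

(** The Casimir element [Cas] is central, and E^m F^m acts on a K-weight space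
    as a polynomial of degree m in it.  Hence E^p = 0 gives a polynomial
    relation x^2 D(x) P = 0, where P projects on a weight of a simple module
    with Casimir eigenvalue c, x = Cas - c and D(0) <> 0.  If H is the multiple
    D (D(0) - D'(0) x) / D(0)^2 of D, then H = 1 modulo x^2, so that H(x) P is
    idempotent; for the highest weight this is e_s^+-.  These idempotents are
    orthogonal since distinct simple modules with a common weight have distinct
    Casimir eigenvalues, they add up to 1, and they are primitive because P A P
    consists of polynomials in Cas.  E and F give the isomorphisms between the
    projective modules attached to the weights of one simple module, while the
    simple modules themselves, realized by matrices, tell the others apart. *)

(** The factors x + [beta] of E^p F^p run over one full period of an index, and the two zeros of
    [beta] in it, at 0 and at the dimension s of the simple module, give the x^2. For s = p the two
    zeros coincide, and already x D(x) P = 0.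

    The formulas encode D. At the highest weight and for s < p, [b0_] and [a0_] are 2p D(x) P and 2p
    x D(x) P, while [gamma_] and [delta_] are 2p D(0) and 2p D'(0), so [e_] is H(x) P written out.

    The obstacle is that [Uq] is only given as a quotient of a free algebra, with no basis at hand.
    Identities are therefore proved in any algebra whose elements E, F, K satisfy the relations,
    which covers [Uq] as well as the matrix algebras of the simple modules. A spanning family
    suffices for finite dimension and for the corners P A P, and every nonvanishing statement is
    read off a matrix representation. *)

Section LeftIdealIsomorphisms.
Variable A : nzRingType.
Implicit Types e f a b : A.

Lemma in_left_ideal e (x : A) : is_idempotent e ->
  reflect (x * e = x) (left_ideal_pred e x).
Proof.
move=> ee; apply: (iffP (asboolP _)) => [[a ->]|<-]; last by exists x.
by rewrite -mulrA ee.
Qed.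

(** Right multiplications by a and b are then inverse maps between A e and A f. In this equational
    form the isomorphism is easy to compose, and nonvanishing passes from one idempotent to the
    other. *)
Definition equiv_idem e f : Prop :=
  exists a b, [/\ a * f = a, b * e = b, a * b = e & b * a = f].

Lemma equiv_idem_refl e : is_idempotent e -> equiv_idem e e.
Proof. by exists e, e. Qed.

Lemma equiv_idem_sym e f : equiv_idem e f -> equiv_idem f e.
Proof. by case=> a [b [af be ab ba]]; exists b, a. Qed.

Lemma equiv_idem_trans f e g :
  equiv_idem e f -> equiv_idem f g -> equiv_idem e g.
Proof.
case=> a [b [af be ab ba]] [a' [b' [ag bf ab' ba']]].
exists (a * a'), (b' * b); split; rewrite -!mulrA ?ag ?be//.
  by rewrite [a' * _]mulrA ab' mulrA af ab.
by rewrite [b * _]mulrA ba mulrA bf ba'.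
Qed.

Lemma equiv_idem_iso e f : is_idempotent e -> is_idempotent f ->
  equiv_idem e f -> lmod_isomorphic (left_ideal e) (left_ideal f).
Proof.
move=> ee ff [a [b [af be ab ba]]].
have mulP (g h c : A) : is_idempotent h -> c * h = c ->
    exists phi : {linear left_ideal g -> left_ideal h},
      forall u, val (phi u) = val u * c.
  move=> hh ch.
  have uP (u : left_ideal g) : left_ideal_pred h (val u * c : A^o).
    by apply/in_left_ideal => //; rewrite -mulrA ch.
  pose phi0 (u : left_ideal g) : left_ideal h :=
    exist _ (val u * c : A^o) (uP u).
  have phi_lin : linear phi0.
    by move=> x u v; apply/val_inj; rewrite /= mulrDl -mulrA.
  pose phiL := GRing.isLinear.Build _ _ _ _ phi0 phi_lin.
  pose phi : {linear left_ideal g -> left_ideal h} :=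
    HB.pack phi0 phiL.
  by exists phi.
have [phi phiE] := mulP e f a ff af.
have [psi psiE] := mulP f e b ee be.
exists phi; exists psi => u; apply/val_inj.
  rewrite psiE phiE -mulrA ab; apply/(in_left_ideal _ ee).
  exact: (svalP u).
rewrite phiE psiE -mulrA ba; apply/(in_left_ideal _ ff).
exact: (svalP u).
Qed.

(** Of the isomorphism only the membership of e in A f A is kept: a ring morphism that kills f then
    kills e, which is how non-isomorphism is proved. *)
Lemma left_ideal_isoW e f : is_idempotent e -> is_idempotent f ->
  lmod_isomorphic (left_ideal e) (left_ideal f) ->
  exists a b, e = a * f * b.
Proof.
move=> ee ff [phi [psi phiK psiK]].
have eP : left_ideal_pred e (e : A^o) by apply/in_left_ideal.
have fP : left_ideal_pred f (f : A^o) by apply/in_left_ideal.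
pose eL : left_ideal e := exist _ (e : A^o) eP.
pose fL : left_ideal f := exist _ (f : A^o) fP.
pose a : A := val (phi eL); pose b : A := val (psi fL).
exists a, b.
have af : a * f = a by apply/(in_left_ideal _ ff); exact: (svalP (phi eL)).
have phieL : phi eL = a *: fL by apply/val_inj; rewrite /= -[RHS]/(a * f) af.
have : psi (phi eL) = a *: psi fL.
  by rewrite phieL; apply: (can_inj phiK); rewrite psiK linearZ /= psiK.
move/(congr1 val); rewrite phiK /= => ->.
by rewrite -mulrA /b; rewrite -[a *: _]/(a * _) [in RHS]mulrA af.
Qed.

End LeftIdealIsomorphisms.

(** * Polynomials modulo X^2, and products over a period *)

Section PolynomialJets.
Variable C : comNzRingType.
Implicit Types (g : {poly C}).

Lemma poly_jet g : exists r, g = (g`_0)%:P + g`_1 *: 'X + 'X^2 * r.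
Proof.
exists (drop_poly 2 g).
rewrite -{1}(poly_take_drop 2 g) mulrC; congr (_ + _).
apply/polyP => i; rewrite coef_take_poly coefD coefC coefZ coefX.
by case: i => [|[|i]] /=; rewrite ?mulr0 ?mulr1 ?addr0 ?add0r.
Qed.

Lemma coef0_prod_XaddC (I : Type) (r : seq I) (P : pred I) (a : I -> C) :
  (\prod_(i <- r | P i) ('X + (a i)%:P))`_0 = \prod_(i <- r | P i) a i.
Proof.
rewrite coef0_prod; apply: eq_bigr => i _.
by rewrite coefD coefX coefC add0r.
Qed.

(** Leibniz rule at 0: differentiating one factor leaves the product of the others. The result has
    the shape of the sums in [delta_]. *)
Lemma coef1_prod_XaddC (I : eqType) (r : seq I) (P : pred I) (a : I -> C) :
  uniq r ->
  (\prod_(i <- r | P i) ('X + (a i)%:P))`_1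
  = \sum_(j <- r | P j) \prod_(i <- r | P i && (i != j)) a i.
Proof.
elim: r => [|k r IH] /=; first by rewrite !big_nil coef1.
case/andP=> kr ur; rewrite !big_cons.
have others : \prod_(i <- r | P i && (i != k)) a i = \prod_(i <- r | P i) a i.
  rewrite big_seq_cond [RHS]big_seq_cond; apply: eq_bigl => i.
  by case: eqP => [->|]; rewrite ?(negbTE kr) ?andbT.
have tail : \sum_(j <- r | P j) \prod_(i <- k :: r | P i && (i != j)) a i
    = \sum_(j <- r | P j)
        (if P k then a k else 1) * \prod_(i <- r | P i && (i != j)) a i.
  rewrite big_seq_cond [RHS]big_seq_cond; apply: eq_bigr => j /andP[jr _].
  rewrite big_cons; have -> : k != j by apply: contraNneq kr => ->.
  by rewrite andbT; case: (P k); rewrite ?mul1r.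
case Pk: (P k); last first.
  by rewrite tail IH// Pk; apply: eq_bigr => j _; rewrite mul1r.
rewrite eqxx andbF others tail Pk -mulr_sumr -IH //.
rewrite mulrDl coefD coefXM /= coefCM coef0_prod_XaddC.
done.
Qed.

End PolynomialJets.

(** A full period may start anywhere. This serves both for sums over the powers of K and for
    products over a period of [beta]. *)
Lemma big_shift_periodic (R : Type) (idx : R) (op : Monoid.com_law idx)
    (n j : nat) (f : nat -> R) :
  (forall m, f (m + n)%N = f m) ->
  \big[op/idx]_(0 <= k < n) f (j + k)%N = \big[op/idx]_(0 <= k < n) f k.
Proof.
move=> fP; elim: j => // j <-.
case: n fP => [|n] fP; first by rewrite !big_geq.
rewrite big_nat_recr//= big_nat_recl// Monoid.mulmC; congr (op _ _).
  by rewrite addSnnS fP addn0.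
by apply: eq_bigr => i _; rewrite addSnnS.
Qed.

(** * Quantum integers and Casimir eigenvalues at a root of unity *)

Section QuantumIntegers.
Variables (C : fieldType) (q : C) (p : nat).
Hypotheses (p2 : (2 <= p)%N) (q_prim : (2 * p).-primitive_root q).

Let p0 : (0 < p)%N. Proof. exact: ltnW. Qed.

Lemma q_neq0 : q != 0.
Proof.
apply/eqP => q0; have := prim_expr_order q_prim.
by rewrite q0 expr0n muln_eq0 /= gtn_eqF// => /esym/eqP; rewrite oner_eq0.
Qed.

Lemma exprz_q_eq1 (a : int) : (q ^ a == 1) = ((2 * p)%:Z %| a)%Z.
Proof.
case: a => n; first by rewrite /= -exprnP -(prim_order_dvd q_prim).
rewrite NegzE -exprnN invr_eq1 -(prim_order_dvd q_prim).
by rewrite dvdzE abszN.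
Qed.

Lemma exprz_q_eq (a b : int) : (q ^ a == q ^ b) = ((2 * p)%:Z %| a - b)%Z.
Proof.
rewrite -exprz_q_eq1 expfzDr ?q_neq0// -invr_expz.
have b0 := expfz_neq0 b q_neq0.
by rewrite -[LHS](inj_eq (mulIf (invr_neq0 b0))) divff.
Qed.

Lemma q_expp : q ^+ p = -1.
Proof.
have : (q ^+ p) ^+ 2 == 1 by rewrite -exprM mulnC prim_expr_order.
rewrite sqrf_eq1 => /orP[|/eqP//].
by rewrite -(prim_order_dvd q_prim) => /dvdn_leq; lia.
Qed.

Lemma exprz_q_addp (a : int) : q ^ (a + p%:Z) = - q ^ a.
Proof. by rewrite expfzDr ?q_neq0// -exprnP q_expp mulrN1. Qed.

Lemma q_subV_neq0 : q - q^-1 != 0.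
Proof.
rewrite subr_eq0 -{1}[q]expr1z -[q^-1]/(q ^ (-1)) exprz_q_eq.
by rewrite dvdzE absz_nat; apply/negP => /dvdn_leq -/(_ isT); rewrite /=; lia.
Qed.

(** The quantum integer on all of Z, where negation and the shift by p become sign changes. *)
Definition br (a : int) : C := (q ^ a - q ^ (- a)) / (q - q^-1).

Lemma brE (n : nat) : br n%:Z = qint q n.
Proof. by rewrite /br -exprnP -exprnN. Qed.

Lemma brN a : br (- a) = - br a.
Proof. by rewrite /br opprK -mulNr opprB. Qed.

Lemma br0 : br 0 = 0.
Proof. by rewrite /br subrr mul0r. Qed.

Lemma br_addp a : br (a + p%:Z) = - br a.
Proof.
rewrite /br exprz_q_addp opprD.
have -> : q ^ (- a - p%:Z) = - q ^ (- a).
  by rewrite -[in RHS](subrK p%:Z (- a)) exprz_q_addp opprK.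
by rewrite -mulNr; congr (_ / _); ring.
Qed.

Lemma br_psub a : br (p%:Z - a) = br a.
Proof. by rewrite addrC br_addp brN opprK. Qed.

Lemma br_eq0 a : (br a == 0) = (p%:Z %| a)%Z.
Proof.
rewrite /br mulf_eq0 invr_eq0 (negbTE q_subV_neq0) orbF subr_eq0 exprz_q_eq.
by rewrite opprK -mulr2n -mulr_natl PoszM; apply: dvdz_mul2l.
Qed.

(* The Casimir eigenvalue on a highest weight vector of weight q^(a-1). *)
Definition cas (a : int) : C := (q ^ a + q ^ (- a)) / (q - q^-1) ^+ 2.

(** A q-analogue of a^2 - (a - 2m)^2 = 4 m (a - m). *)
Lemma cas_sub (a m : int) : cas a - cas (a - m *+ 2) = br m * br (a - m).
Proof.
have q0 := q_neq0; have d0 := q_subV_neq0.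
rewrite /cas /br !(opprB, mulr2n, opprD, expfzDr, q0)// -!invr_expz.
have := expfz_neq0 a q0; have := expfz_neq0 m q0.
move: (q ^ a) (q ^ m) => u v v0 u0.
move: (q - q^-1) d0 => d d0; field.
by rewrite u0 v0 d0 oner_neq0.
Qed.

(** Up to a unit the difference is (q^a - q^b) (q^(a+b) - 1), whence the two alternatives. *)
Lemma cas_eq (a b : int) :
  (cas a == cas b) = ((2 * p)%:Z %| a - b)%Z || ((2 * p)%:Z %| a + b)%Z.
Proof.
have q0 := q_neq0; have d0 := q_subV_neq0.
rewrite -exprz_q_eq -exprz_q_eq1.
rewrite -subr_eq0 -[q ^ a == _]subr_eq0 -[q ^ (a + b) == _]subr_eq0.
have -> : cas a - cas b
    = (q ^ a - q ^ b) * ((q ^ (a + b) - 1) * (q ^ (- a - b) / (q - q^-1) ^+ 2)).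
  rewrite /cas !(expfzDr, q0)// -!invr_expz.
  have := expfz_neq0 a q0; have := expfz_neq0 b q0.
  move: (q ^ a) (q ^ b) (q - q^-1) d0 => u v d d0 v0 u0.
  by field; rewrite u0 v0 d0.
rewrite !mulf_eq0 invr_eq0 sqrf_eq0 (negbTE d0) orbF.
by rewrite (negbTE (expfz_neq0 _ q0)) orbF.
Qed.

Lemma cas_add1_sub (z : int) :
  cas (z + 1) - cas (z - 1) = (q - q^-1)^-1 * (q ^ z - q ^ (- z)).
Proof.
have qn0 := q_neq0; have d0 := q_subV_neq0.
rewrite /cas !opprD opprK !(@expfzDr C q)// -!invr_expz !expr1z.
have := expfz_neq0 z qn0; move: (q ^ z) (q^-1) d0 => w r d0 w0.
by field; rewrite w0 d0.
Qed.

End QuantumIntegers.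

(** * Weights of the simple modules modulo 2p *)

Section LinkedWeights.
Variable p : nat.
Hypothesis p0 : (0 < p)%N.

(* The simple modules X^+-(s) are indexed by i = b p + s - 1 < 2 p, with b = 0
   for + and b = 1 for -: X_i has dimension [sdim i] = s, its highest weight is
   q^i, and [wt i j] is the exponent of the weight of its j-th basis vector. *)
Definition wt (i j : nat) : int := i%:Z - (j * 2)%:Z.

Definition sdim (i : nat) : nat := (i %% p).+1.

Lemma sdim_le i : (sdim i <= p)%N.
Proof. by rewrite /sdim ltn_mod. Qed.

Lemma dvdz_small (m n : nat) : (m <= p)%N -> (n <= p)%N -> (0 < m)%N ->
  (0 < n)%N -> (p%:Z %| m%:Z - n%:Z)%Z -> m = n.
Proof.
move=> mp np m0 n0; rewrite dvdzE /=; have [->//|mn] := eqVneq m n.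
move/dvdn_leq; lia.
Qed.

Lemma sdimE i : i.+1%:Z = (i %/ p)%:Z * p%:Z + (sdim i)%:Z.
Proof. by rewrite /sdim {1}(divn_eq i p) -addnS PoszD PoszM. Qed.

Lemma sdim_lt i : (i < p)%N -> sdim i = i.+1.
Proof. by move=> ip; rewrite /sdim modn_small. Qed.

Lemma sdim_ge i : (p <= i < 2 * p)%N -> sdim i = (i - p).+1.
Proof.
move=> /andP[pi i2]; rewrite /sdim -{1}(subnK pi) modnDr modn_small//; lia.
Qed.

Lemma dvd2p_eq0 (a : int) :
  ((2 * p)%:Z %| a)%Z -> - (2 * p)%:Z < a -> a < (2 * p)%:Z -> a = 0.
Proof.
move=> + a1 a2; rewrite dvdzE /=; have [//|a0] := eqVneq a 0.
move/dvdn_leq; lia.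
Qed.

(* The simple modules indexed by [i] and by [2p - 2 - i] have the same Casimir
   eigenvalue, but their weights are disjoint. *)
Lemma linked_weights i j k l :
  (i < 2 * p)%N -> (k < 2 * p)%N -> (j < sdim i)%N -> (l < sdim k)%N ->
  ((2 * p)%:Z %| wt i j - wt k l)%Z ->
  ((2 * p)%:Z %| i.+1%:Z - k.+1%:Z)%Z || ((2 * p)%:Z %| i.+1%:Z + k.+1%:Z)%Z ->
  i = k /\ j = l.
Proof.
move=> i2 k2 ji lk dw lnk.
have same : i = k -> i = k /\ j = l.
  move=> ik; split=> //; subst k.
  have := sdim_le i => si; have := dvd2p_eq0 dw; rewrite /wt.
  clear dw lnk; lia.
case/orP: lnk => [h|h].
  by apply: same; have := dvd2p_eq0 h; clear h dw; lia.
have [/same //|ik] := eqVneq i k.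
(* The next multiple 4p would require i = k = 2p - 1, which [ik] excludes. *)
have e : (i + k + 2 = 2 * p)%N.
  have h2 : ((2 * p)%:Z %| i.+1%:Z + k.+1%:Z - (2 * p)%:Z)%Z.
    by rewrite rpredB ?dvdzz.
  by have := dvd2p_eq0 h2; clear h h2 dw; lia.
(* If i < p, the weights of X_i are -i, ..., i and those of X_k are i + 2, ..., 2p - 2 - i, in steps
   of 2, so their differences lie strictly between -2p and 0. The other case is symmetric. *)
have [ip|pi] := ltnP i p.
  have kp : (p <= k)%N by lia.
  have d2 : ((2 * p)%:Z %| wt i j - wt k l + (2 * p)%:Z)%Z.
    by rewrite rpredD ?dvdzz.
  have := dvd2p_eq0 d2; clear h d2 dw same.
  move: ji lk; rewrite (sdim_lt ip) sdim_ge ?kp// /wt; lia.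
have kp : (k < p)%N by lia.
have d2 : ((2 * p)%:Z %| wt i j - wt k l - (2 * p)%:Z)%Z.
  by rewrite rpredB ?dvdzz.
have := dvd2p_eq0 d2; clear h d2 dw same.
move: ji lk; rewrite (sdim_lt kp) sdim_ge ?pi// /wt; lia.
Qed.

(** Every Casimir eigenvalue occurring in E^p F^p on weight n belongs to a simple module that has
    this weight. With a = n - 1 - 2k modulo 2p, the candidates are i + 1 = a and its linked partner
    i + 1 = 2p - a. Solving i - 2j = n modulo 2p gives j = p - 1 - k for the first and j = -a - 1 -
    k modulo p for the second, and one of the two is in range. *)
Lemma weight_in_chain n k : (n < 2 * p)%N -> (k < p)%N ->
  exists i j, [/\ (i < 2 * p)%N, (j < sdim i)%N,
    ((2 * p)%:Z %| wt i j - n%:Z)%Z &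
    ((2 * p)%:Z %| i.+1%:Z - (n%:Z - 1 - (k * 2)%:Z))%Z
    || ((2 * p)%:Z %| i.+1%:Z + (n%:Z - 1 - (k * 2)%:Z))%Z].
Proof.
move=> n2 kp.
have dE (x s : int) : x = s * (2 * p)%:Z -> ((2 * p)%:Z %| x)%Z.
  by move=> ->; rewrite dvdz_mull.
have [a [t [a2 tE ta]]] : exists (a : nat) (t : int), [/\ (a < 2 * p)%N,
    t = 0 \/ t = -1 & n%:Z = a%:Z + 1 + (k * 2)%:Z + t * (2 * p)%:Z].
  have [h|h] := leqP (1 + k * 2) n.
    by exists (n - (1 + k * 2))%N, 0; split; [lia|left|lia].
  by exists (n + 2 * p - (1 + k * 2))%N, (-1); split; [lia|right|lia].
have ca b : b%:Z = a%:Z \/ b%:Z + a%:Z = (2 * p)%:Z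
      \/ b%:Z - a%:Z = (2 * p)%:Z ->
    ((2 * p)%:Z %| b%:Z - (n%:Z - 1 - (k * 2)%:Z))%Z
    || ((2 * p)%:Z %| b%:Z + (n%:Z - 1 - (k * 2)%:Z))%Z.
  move=> h; have -> : n%:Z - 1 - (k * 2)%:Z = a%:Z + t * (2 * p)%:Z.
    by rewrite ta; ring.
  case: h => [->|[h|h]].
  - by apply/orP; left; apply: (dE _ (- t)); ring.
  - by apply/orP; right; apply: (dE _ (t + 1)); rewrite addrA h; ring.
  - by apply/orP; left; apply: (dE _ (1 - t)); rewrite opprD addrA h; ring.
have [a0|a0] := posnP a.
  (* Here i + 1 = 2p: a module of dimension p, which has every weight of its parity and no linked
     partner. *)
  exists (2 * p).-1, (p - 1 - k)%N.
  rewrite sdim_ge; last lia.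
  split; [lia | lia | | by apply: ca; lia].
  by apply: (dE _ (- t)); case: tE ta => -> ta; rewrite /wt; lia.
have [js|js] := ltnP (p - 1 - k) (sdim a.-1).
  exists a.-1, (p - 1 - k)%N; split; [lia | by [] | | by apply: ca; lia].
  by apply: (dE _ (- 1 - t)); case: tE ta => -> ta; rewrite /wt; lia.
have [ap|pa] := leqP a p.
  move: js; rewrite sdim_lt; last lia.
  move=> js; exists (2 * p - a - 1)%N, (p - 1 - a - k)%N.
  rewrite sdim_ge; last lia.
  split; [lia | lia | | by apply: ca; lia].
  by apply: (dE _ (- t)); case: tE ta => -> ta; rewrite /wt; lia.
move: js; rewrite sdim_ge; last lia.
move=> js; exists (2 * p - a - 1)%N, (2 * p - 1 - a - k)%N.
rewrite sdim_lt; last lia.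
split; [lia | lia | | by apply: ca; lia].
by apply: (dE _ (- 1 - t)); case: tE ta => -> ta; rewrite /wt; lia.
Qed.

End LinkedWeights.

Lemma dvdz_subC (n a b : int) : (n %| a - b)%Z = (n %| b - a)%Z.
Proof. by rewrite -opprB !dvdzE abszN. Qed.

Lemma horner_alg_comm (C : fieldType) (A : algType C) (a b : A) (g : {poly C}) :
  a * b = b * a -> a * horner_alg b g = horner_alg b g * a.
Proof.
move=> ab; elim/poly_ind: g => [|g c IH]; first by rewrite !rmorph0 mulr0 mul0r.
rewrite rmorphD rmorphM /= horner_algX horner_algC mulrDr mulrDl.
by rewrite mulrA IH -!mulrA ab -scalerAr -scalerAl mulr1 mul1r.
Qed.

(** * Algebras with the relations: weight projections and the Casimir element *)

Section UqStructure.
Variables (C : fieldType) (q : C) (p : nat).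
Hypotheses (p2 : (2 <= p)%N) (q_prim : (2 * p).-primitive_root q).
Hypothesis char_2p : (2 * p)%:R != 0 :> C.
Variables (A : algType C) (E F K : A).
Hypothesis rels : forall x, Uq_relations q p E F K x -> x = 0.

Let p0 : (0 < p)%N. Proof. exact: ltnW. Qed.
Let q0 : q != 0. Proof. exact: q_neq0 p2 q_prim. Qed.
Let d0 : q - q^-1 != 0. Proof. exact: q_subV_neq0 p2 q_prim. Qed.

Local Notation Ki := (K ^+ (2 * p).-1).

Lemma Uq_EXp : E ^+ p = 0.
Proof. by apply: rels; rewrite /Uq_relations /= !inE eqxx. Qed.

Lemma Uq_FXp : F ^+ p = 0.
Proof. by apply: rels; rewrite /Uq_relations /= !inE eqxx orbT. Qed.

Lemma Uq_KX2p : K ^+ (2 * p) = 1.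
Proof. by apply/subr0_eq/rels; rewrite /Uq_relations /= !inE eqxx !orbT. Qed.

Lemma Uq_KiK : Ki * K = 1.
Proof. by rewrite -exprSr prednK ?Uq_KX2p// muln_gt0. Qed.

Lemma Uq_KKi : K * Ki = 1.
Proof. by rewrite -exprS prednK ?Uq_KX2p// muln_gt0. Qed.

Lemma Uq_KE : K * E = q ^+ 2 *: (E * K).
Proof.
rewrite -[LHS]mulr1 -Uq_KiK mulrA.
have -> : K * E * Ki = q ^+ 2 *: E.
  by apply/subr0_eq/rels; rewrite /Uq_relations /= !inE eqxx !orbT.
by rewrite -scalerAl.
Qed.

Lemma Uq_KF : K * F = q ^- 2 *: (F * K).
Proof.
rewrite -[LHS]mulr1 -Uq_KiK mulrA.
have -> : K * F * Ki = q ^- 2 *: F.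
  by apply/subr0_eq/rels; rewrite /Uq_relations /= !inE eqxx !orbT.
by rewrite -scalerAl.
Qed.

Lemma Uq_EF : E * F = F * E + (q - q^-1)^-1 *: (K - Ki).
Proof.
rewrite addrC; apply/eqP; rewrite -subr_eq; apply/eqP/subr0_eq/rels.
by rewrite /Uq_relations /= !inE eqxx !orbT.
Qed.

(** Fourier projection onto the q^z-eigenspace of K. It depends on z only modulo 2p, but integer
    indices make the shifts by E and F plain additions. *)
Definition wproj (z : int) : A :=
  (2 * p)%:R^-1 *: \sum_(0 <= l < 2 * p) (q ^ (- z)) ^+ l *: K ^+ l.

Lemma wproj_eq (a b : int) : ((2 * p)%:Z %| a - b)%Z -> wproj a = wproj b.
Proof.
rewrite -(exprz_q_eq p2 q_prim) => /eqP ab.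
by rewrite /wproj -!invr_expz ab.
Qed.

Lemma exprz_q_X2p z : (q ^ z) ^+ (2 * p) = 1.
Proof.
by rewrite exprnP exprz_exp; apply/eqP; rewrite (exprz_q_eq1 q_prim) dvdz_mull.
Qed.

Lemma K_wproj z : K * wproj z = q ^ z *: wproj z.
Proof.
have qz := expfz_neq0 z q0.
rewrite /wproj -scalerAr scalerA mulrC -scalerA; congr (_ *: _).
rewrite mulr_sumr scaler_sumr.
pose f l := q ^ z *: ((q ^ (- z)) ^+ l *: K ^+ l).
rewrite -[RHS](big_shift_periodic _ 1 (f := f)); last first.
  by move=> m; rewrite /f (exprD _ m) (exprD K m) exprz_q_X2p Uq_KX2p !mulr1.
apply: eq_bigr => l _; rewrite /f add1n scalerA -scalerAr -exprS.
rewrite [(q ^ _) ^+ l.+1]exprS mulrA.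
by rewrite -invr_expz divff// mul1r.
Qed.

Lemma wproj_eigen (z w : int) (x : A) : K * x = q ^ w *: x ->
  wproj z * x = if ((2 * p)%:Z %| z - w)%Z then x else 0.
Proof.
move=> Kx; have KXx l : K ^+ l * x = (q ^ w) ^+ l *: x.
  elim: l => [|l IH]; first by rewrite mul1r scale1r.
  by rewrite exprSr -mulrA Kx -scalerAr IH scalerA -exprS.
rewrite /wproj -scalerAl mulr_suml.
rewrite (eq_bigr (fun l => (q ^ (w - z)) ^+ l *: x)); last first.
  move=> l _; rewrite -scalerAl KXx scalerA -exprMn.
  by rewrite -expfzDr// addrC.
rewrite -scaler_suml scalerA.
case: ifPn => [|zw].
  rewrite dvdz_subC -(exprz_q_eq1 q_prim) => /eqP ->.
  rewrite (eq_bigr (fun=> 1)); last by move=> l _; rewrite expr1n.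
  by rewrite sumr_const_nat subn0 mulVf// scale1r.
have qwz : q ^ (w - z) - 1 != 0.
  by rewrite subr_eq0 (exprz_q_eq1 q_prim) dvdz_subC.
suff -> : \sum_(0 <= l < 2 * p) (q ^ (w - z)) ^+ l = 0 by rewrite mulr0 scale0r.
apply: (mulfI qwz); rewrite mulr0 big_mkord -subrX1.
by rewrite exprz_q_X2p subrr.
Qed.

Lemma wproj_mul (z w : int) :
  wproj z * wproj w = if ((2 * p)%:Z %| z - w)%Z then wproj w else 0.
Proof. exact/wproj_eigen/K_wproj. Qed.

Lemma wproj_idem z : wproj z * wproj z = wproj z.
Proof. by rewrite wproj_mul subrr dvdz0. Qed.

Lemma sum_wproj : \sum_(n < 2 * p) wproj n = 1.
Proof.
rewrite /wproj -scaler_sumr exchange_big /= big_ltn ?muln_gt0//.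
rewrite [X in _ + X]big_nat_cond [X in _ + X]big1 ?addr0; last first.
  move=> l /andP[/andP[l0 l2p] _]; rewrite -scaler_suml.
  suff -> : \sum_(n < 2 * p) (q ^ (- n%:Z)) ^+ l = 0 by rewrite scale0r.
  have ql : q ^ (- l%:Z) - 1 != 0.
    rewrite subr_eq0 (exprz_q_eq1 q_prim) dvdzE abszN /=.
    by apply/negP => /dvdn_leq; lia.
  rewrite (eq_bigr (fun n : 'I__ => (q ^ (- l%:Z)) ^+ n)); last first.
    by move=> n _; rewrite !exprnP !exprz_exp !mulNr [(n%:Z * _)]mulrC.
  by apply: (mulfI ql); rewrite mulr0 -subrX1 exprz_q_X2p subrr.
rewrite (eq_bigr (fun=> 1)); last by move=> n _; rewrite !expr0 scale1r.
by rewrite sumr_const card_ord -scaler_nat scalerA mulVf// scale1r.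
Qed.

Lemma KX_shift (x : A) (a : C) l : K * x = a *: (x * K) ->
  K ^+ l * x = a ^+ l *: (x * K ^+ l).
Proof.
move=> Kx; elim: l => [|l IH]; first by rewrite scale1r mul1r mulr1.
rewrite exprSr -mulrA Kx -scalerAr [K ^+ l * (x * _)]mulrA IH -scalerAl scalerA.
by rewrite -exprS -mulrA -exprSr.
Qed.

Lemma wproj_shift (x : A) (m z : int) : K * x = q ^ m *: (x * K) ->
  x * wproj z = wproj (z + m) * x.
Proof.
move=> Kx; rewrite /wproj -scalerAl -scalerAr mulr_suml mulr_sumr.
congr (_ *: _); apply: eq_bigr => l _.
rewrite -scalerAl (KX_shift _ Kx) scalerA -exprMn -scalerAr.
by rewrite -expfzDr// opprD -addrA addNr addr0.
Qed.

Lemma E_wproj z : E * wproj z = wproj (z + 2) * E.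
Proof. exact/wproj_shift/Uq_KE. Qed.

Lemma F_wproj z : F * wproj z = wproj (z - 2) * F.
Proof. exact/wproj_shift/Uq_KF. Qed.

Definition Cas : A :=
  F * E + (q - q^-1) ^- 2 *: (q *: K + q^-1 *: Ki).

Lemma Cas_EF : Cas = E * F + (q - q^-1) ^- 2 *: (q^-1 *: K + q *: Ki).
Proof.
rewrite Uq_EF /Cas -addrA; congr (_ + _).
rewrite !scalerDr !scalerA scalerN addrACA -scalerDl -scaleNr -scalerDl.
by congr (_ *: _ + _ *: _); move: (q^-1) d0 => r rq0; field.
Qed.

Lemma Uq_KiE : Ki * E = q ^- 2 *: (E * Ki).
Proof.
have q20 : q ^+ 2 != 0 by rewrite expf_neq0.
apply: (scalerI q20); rewrite scalerA divff// scale1r.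
rewrite -[RHS]mul1r -Uq_KiK -mulrA [K * (E * _)]mulrA Uq_KE.
by rewrite -!scalerAl -!scalerAr -!mulrA Uq_KKi mulr1.
Qed.

Lemma Uq_KiF : Ki * F = q ^+ 2 *: (F * Ki).
Proof.
have q20 : q ^- 2 != 0 by rewrite invr_neq0// expf_neq0.
apply: (scalerI q20); rewrite scalerA mulVf ?expf_neq0// scale1r.
rewrite -[RHS]mul1r -Uq_KiK -mulrA [K * (F * _)]mulrA Uq_KF.
by rewrite -!scalerAl -!scalerAr -!mulrA Uq_KKi mulr1.
Qed.

(** Expanding [Cas] with F E on one side and with E F on the other puts E F E on both; the parts in
    K then match by q-commutation. *)
Lemma E_Cas : E * Cas = Cas * E.
Proof.
rewrite [in RHS]Cas_EF /Cas mulrDr mulrDl mulrA; congr (_ + _).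
rewrite -scalerAr -scalerAl mulrDr mulrDl -!scalerAr -!scalerAl; congr (_ *: _).
rewrite Uq_KE Uq_KiE !scalerA.
by congr (_ *: _ + _ *: _); field; rewrite ?q0 ?oner_neq0.
Qed.

Lemma F_Cas : F * Cas = Cas * F.
Proof.
rewrite [in LHS]Cas_EF /Cas mulrDr mulrDl mulrA; congr (_ + _).
rewrite -scalerAr -scalerAl mulrDr mulrDl -!scalerAr -!scalerAl; congr (_ *: _).
rewrite Uq_KF Uq_KiF !scalerA.
by congr (_ *: _ + _ *: _); field; rewrite ?q0 ?oner_neq0.
Qed.

Lemma K_Cas : K * Cas = Cas * K.
Proof.
rewrite /Cas mulrDr mulrDl; congr (_ + _).
  rewrite mulrA Uq_KF -scalerAl -[F * K * E]mulrA Uq_KE -scalerAr scalerA.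
  by rewrite mulVf ?expf_neq0// scale1r mulrA.
rewrite -scalerAr -scalerAl mulrDr mulrDl -!scalerAr -!scalerAl.
by rewrite Uq_KKi Uq_KiK.
Qed.

Lemma comm_wproj (x : A) z : K * x = x * K -> wproj z * x = x * wproj z.
Proof.
by move=> Kx; rewrite (wproj_shift (m := 0)) ?addr0// expr0z scale1r.
Qed.

Lemma wproj_Cas z : wproj z * Cas = Cas * wproj z.
Proof. exact/comm_wproj/K_Cas. Qed.

Lemma Ki_wproj z : Ki * wproj z = q ^ (- z) *: wproj z.
Proof.
rewrite -[LHS]scale1r -(mulVf (expfz_neq0 z q0)) -scalerA scalerAr -K_wproj.
by rewrite mulrA Uq_KiK mul1r invr_expz.
Qed.

Lemma FE_wproj z : F * E * wproj z = (Cas - (cas q (z + 1))%:A) * wproj z.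
Proof.
rewrite mulrBl /Cas mulrDl -scalerAl mulrDl -!scalerAl K_wproj Ki_wproj mul1r.
rewrite !scalerA -scalerDl scalerA -addrA -scalerBl.
rewrite [X in X *: _](_ : _ = 0) ?scale0r ?addr0//.
rewrite /cas opprD !(@expfzDr C q)// expr1z exprN1.
by move: ((q - q^-1) ^- 2) (q^-1) => d r; ring.
Qed.

Lemma EF_wproj z : E * F * wproj z = (Cas - (cas q (z - 1))%:A) * wproj z.
Proof.
rewrite mulrBl Cas_EF mulrDl -scalerAl mulrDl -!scalerAl K_wproj Ki_wproj mul1r.
rewrite !scalerA -scalerDl scalerA -addrA -scalerBl.
rewrite [X in X *: _](_ : _ = 0) ?scale0r ?addr0//.
rewrite /cas opprB !(@expfzDr C q)// expr1z exprN1.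
by move: ((q - q^-1) ^- 2) (q^-1) => d r; ring.
Qed.

(** Evaluation is recentred at an eigenvalue c, so that working modulo X^2 describes the generalized
    eigenspace of c. *)
Local Notation pev c := (horner_alg (Cas - c%:A)).

Lemma comm_pev (x : A) c g : x * Cas = Cas * x -> x * pev c g = pev c g * x.
Proof.
move=> xC; apply: horner_alg_comm.
by rewrite mulrBr mulrBl xC -scalerAr -scalerAl mulr1 mul1r.
Qed.

Lemma wproj_pev z c g : wproj z * pev c g = pev c g * wproj z.
Proof. exact/comm_pev/wproj_Cas. Qed.

Lemma pevXD c d : pev c ('X + d%:P) = Cas - (c - d)%:A.
Proof.
rewrite rmorphD /= horner_algX horner_algC scalerBl opprB.
by rewrite (addrC d%:A) addrA.
Qed.

Lemma pevXD0 c d : pev c ('X + (c - d)%:P) = Cas - d%:A.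
Proof. by rewrite pevXD subKr. Qed.

Lemma EX_wproj k z : E ^+ k * wproj z = wproj (z + (k * 2)%:Z) * E ^+ k.
Proof.
elim: k z => [|k IH] z; first by rewrite mul1r mulr1 addr0.
rewrite exprSr -mulrA E_wproj mulrA IH -mulrA -exprSr; congr (wproj _ * _).
lia.
Qed.

Lemma FX_wproj k z : F ^+ k * wproj z = wproj (z - (k * 2)%:Z) * F ^+ k.
Proof.
elim: k z => [|k IH] z; first by rewrite mul1r mulr1 subr0.
rewrite exprSr -mulrA F_wproj mulrA IH -mulrA -exprSr; congr (wproj _ * _).
lia.
Qed.

(** After F^m the weight is z - 2m, where the innermost E F is a central element Cas - const that
    can be pulled out. The centre c is free; it will be either 0 or the eigenvalue of a simple
    module. *)
Lemma EXFX_wproj m z c :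
  E ^+ m * F ^+ m * wproj z
  = pev c (\prod_(0 <= k < m) ('X + (c - cas q (z - 1 - (k * 2)%:Z))%:P))
    * wproj z.
Proof.
elim: m => [|m IH]; first by rewrite big_geq// !mul1r rmorph1 mul1r.
rewrite big_nat_recr//= [_ * ('X + _)]mulrC rmorphM /= -[RHS]mulrA -IH pevXD0.
set a := (cas q _)%:A.
have EX_Cas : E ^+ m * (Cas - a) = (Cas - a) * E ^+ m.
  rewrite mulrBr mulrBl /a -scalerAr -scalerAl mulr1 mul1r; congr (_ - _).
  by apply/esym/commrX/esym/E_Cas.
transitivity (E ^+ m * (E * F * wproj (z - (m * 2)%:Z)) * F ^+ m).
  by rewrite exprSr exprS -!mulrA FX_wproj.
rewrite EF_wproj [z - _ - 1]addrAC -/a mulrA EX_Cas -!mulrA; congr (_ * (_ * _)).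
by rewrite FX_wproj.
Qed.

(** * The polynomials D and H, and the idempotents *)

(* E F^m v = beta i m F^(m-1) v for a highest weight vector v of X_i. *)
Definition beta (i m : nat) : C := br q m * br q (i.+1%:Z - m%:Z).

Lemma beta_addp i m : beta i (m + p) = beta i m.
Proof.
rewrite /beta PoszD opprD addrA !(br_addp p2 q_prim).
rewrite -[in RHS](subrK p%:Z (_ - m%:Z)) (br_addp p2 q_prim).
by rewrite mulrN mulNr.
Qed.

Lemma cas_wt i j k :
  cas q i.+1 - cas q (wt i j - 1 - (k * 2)%:Z) = beta i (j + k).+1.
Proof.
rewrite /beta -(cas_sub p2 q_prim) /wt; congr (_ - cas q _); lia.
Qed.

Local Notation sdim := (sdim p).

Lemma pevZ c a g : pev c (a *: g) = a *: pev c g.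
Proof. by rewrite -mul_polyC rmorphM /= horner_algC -scalerAl mul1r. Qed.

Lemma pevD c g h : pev c (g + h) = pev c g + pev c h.
Proof. exact: rmorphD. Qed.

Lemma pevB c g h : pev c (g - h) = pev c g - pev c h.
Proof. exact: rmorphB. Qed.

Lemma pev_sum c (I : Type) (r : seq I) (P : pred I) (G : I -> {poly C}) :
  pev c (\sum_(i <- r | P i) G i) = \sum_(i <- r | P i) pev c (G i).
Proof. exact: raddf_sum. Qed.

Lemma pevM c g h : pev c (g * h) = pev c g * pev c h.
Proof. exact: rmorphM. Qed.

Lemma pevMC c g h : pev c (g * h) = pev c h * pev c g.
Proof. by rewrite mulrC pevM. Qed.

Lemma beta_eq0 i m : (0 < m < p)%N -> (beta i m == 0) = (m == sdim i).
Proof.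
case/andP=> m0 mp; rewrite /beta mulf_eq0 !(br_eq0 p2 q_prim).
rewrite [(_ %| m%:Z)%Z]dvdzE /= [(_ %| _)%N](negbTE _); last first.
  by apply/negP => /dvdn_leq; lia.
rewrite /= (sdimE p) -addrA rpredDl ?dvdz_mull//.
apply/idP/eqP => [h|->]; last by rewrite subrr dvdz0.
by apply/esym/(@dvdz_small p) => //; rewrite ?(sdim_le p0)// ltnW.
Qed.

Lemma beta_sdim i : beta i (sdim i) = 0.
Proof.
rewrite /beta (sdimE p) addrK; apply/eqP.
by rewrite mulf_eq0 !(br_eq0 p2 q_prim) dvdz_mull// orbT.
Qed.

Lemma beta0 i : beta i 0 = 0.
Proof. by rewrite /beta br0 mul0r. Qed.

(** One period of the factors X + [beta i m] without those where [beta] vanishes, so that D(0) is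
    nonzero. For [sdim i = p] the filter removes nothing. *)
Definition Dpol (i : nat) : {poly C} :=
  \prod_(1 <= m < p | m != sdim i) ('X + (beta i m)%:P).

Lemma Dpol0_neq0 i : (Dpol i)`_0 != 0.
Proof.
rewrite coef0_prod_XaddC big_seq_cond prodf_seq_neq0.
apply/allP => m; rewrite mem_index_iota => mp.
by apply/implyP => /andP[_ ms]; rewrite beta_eq0.
Qed.

Definition Hpol (i : nat) : {poly C} :=
  ((Dpol i)`_0) ^- 2 *: (Dpol i * (((Dpol i)`_0)%:P - (Dpol i)`_1 *: 'X)).

Lemma Hpol_jet i : exists r, Hpol i = 1 + 'X^2 * r.
Proof.
have [r] := poly_jet (Dpol i); have := Dpol0_neq0 i; rewrite /Hpol.
move: (Dpol i)`_0 (Dpol i)`_1 => a b a0 ->.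
exists (a ^- 2 *: (r * (a%:P - b *: 'X) - (b ^+ 2)%:P)).
have -> : (a%:P + b *: 'X + 'X^2 * r) * (a%:P - b *: 'X)
    = (a ^+ 2)%:P + 'X^2 * (r * (a%:P - b *: 'X) - (b ^+ 2)%:P).
  by rewrite -!mul_polyC !rmorphXn /=; ring.
by rewrite scalerDr -scalerAr -[_ *: _%:P]mul_polyC -polyCM mulVf ?expf_neq0.
Qed.

Lemma prod_beta i :
  \prod_(0 <= k < p) ('X + (beta i k)%:P)
  = 'X * (if (sdim i < p)%N then 'X else 1) * Dpol i.
Proof.
rewrite big_ltn// beta0 addr0 -mulrA; congr (_ * _).
case: ifPn => [sp|]; last first.
  rewrite -leqNgt => ps; rewrite mul1r /Dpol [RHS]big_nat_cond big_nat_cond.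
  by apply: eq_bigl => m; apply/andb_id2l => /andP[_ mp]; lia.
have sr : sdim i \in index_iota 1 p by rewrite mem_index_iota.
by rewrite (bigD1_seq _ sr) ?iota_uniq//= beta_sdim addr0.
Qed.

Local Notation ci i := (cas q i.+1%:Z).

(** At the weight [wt i j] the factors of E^p F^p = 0 are indexed from j + 1 to j + p; by
    periodicity all weights of X_i obey the same relation. *)
Lemma pev_prod_beta_wproj i j :
  pev (ci i) (\prod_(0 <= k < p) ('X + (beta i k)%:P)) * wproj (wt i j) = 0.
Proof.
have := EXFX_wproj p (wt i j) (ci i).
rewrite Uq_EXp mul0r mul0r.
rewrite (eq_bigr (fun k => 'X + (beta i (j.+1 + k)%N)%:P)); last first.
  by move=> k _; rewrite cas_wt addSn.
rewrite (big_shift_periodic _ _ (f := fun k => 'X + (beta i k)%:P)) => [<-//|m].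
by rewrite beta_addp.
Qed.

Lemma pev_Dpol_wproj i j : pev (ci i) ('X^2 * Dpol i) * wproj (wt i j) = 0.
Proof.
have := pev_prod_beta_wproj i j; rewrite prod_beta expr2.
(* In dimension p the relation X D P = 0 is stronger; it is multiplied by X to treat all i alike. *)
case: ifP => // _; rewrite mulr1 => h.
by rewrite -mulrA pevM -mulrA h mulr0.
Qed.

Definition idem i j : A := pev (ci i) (Hpol i) * wproj (wt i j).

Lemma pevX2_idem i j : pev (ci i) 'X^2 * idem i j = 0.
Proof.
rewrite /idem /Hpol pevZ -scalerAl -scalerAr mulrA -pevM mulrA pevMC -mulrA.
by rewrite pev_Dpol_wproj mulr0 scaler0.
Qed.

Lemma pev_Hpol_idem i (x : A) : pev (ci i) 'X^2 * x = 0 ->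
  pev (ci i) (Hpol i) * x = x.
Proof.
move=> x2; have [r ->] := Hpol_jet i.
by rewrite rmorphD rmorph1 /= pevMC mulrDl mul1r -mulrA x2 mulr0 addr0.
Qed.

Lemma idem_wproj i j : idem i j * wproj (wt i j) = idem i j.
Proof. by rewrite -mulrA wproj_idem. Qed.

Lemma wproj_idem_l i j : wproj (wt i j) * idem i j = idem i j.
Proof. by rewrite mulrA wproj_pev -mulrA wproj_idem. Qed.

Lemma idemP i j : is_idempotent (idem i j).
Proof.
rewrite /is_idempotent {1}/idem -mulrA wproj_idem_l.
exact/pev_Hpol_idem/pevX2_idem.
Qed.

(** Coprimality of (X - a)^2 and (X - b)^2, made explicit through Cas - b = (Cas - a) + (a - b),
    where the square of the first term kills x. *)
Lemma Cas_eigen_disjoint (a b : C) (x : A) : a != b ->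
  pev a 'X^2 * x = 0 -> pev b 'X^2 * x = 0 -> x = 0.
Proof.
move=> ab; rewrite !expr2 !pevM !horner_algX -!mulrA => ax bx.
pose y := (Cas - a%:A) * x; pose d := a - b.
have d0' : d != 0 by rewrite subr_eq0.
have shift z : (Cas - b%:A) * z = (Cas - a%:A) * z + d *: z.
  by rewrite !mulrBl /d scalerBl -!scalerAl !mul1r addrA subrK.
move: bx; rewrite !shift mulrDr ax add0r -scalerAr -/y.
rewrite scalerDr addrA -scalerDl scalerA => bx.
have y0 : y = 0.
  have := congr1 (fun z => (Cas - a%:A) * z) bx.
  rewrite mulr0 mulrDr -!scalerAr -/y ax scaler0 add0r => /eqP.
  by rewrite scaler_eq0 mulf_eq0 (negbTE d0') => /eqP.
move/eqP: bx; rewrite y0 scaler0 add0r scaler_eq0 mulf_eq0 (negbTE d0').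
by move/eqP.
Qed.

Lemma idem_pev c g i j : idem i j * pev c g = pev c g * idem i j.
Proof.
apply: comm_pev; rewrite /idem -mulrA wproj_Cas !mulrA; congr (_ * _).
by apply/esym/comm_pev.
Qed.

Lemma idem_orthogonal i j k l :
  (i < 2 * p)%N -> (k < 2 * p)%N -> (j < sdim i)%N -> (l < sdim k)%N ->
  (i != k) || (j != l) -> idem i j * idem k l = 0.
Proof.
move=> i2 k2 ji lk neq.
have [dw|dw] := boolP ((2 * p)%:Z %| wt i j - wt k l)%Z; last first.
  by rewrite -idem_wproj -(wproj_idem_l k) -mulrA [wproj _ * (_ * _)]mulrA
    wproj_mul (negbTE dw) mul0r mulr0.
apply: (@Cas_eigen_disjoint (ci i) (ci k)); last first.
- by rewrite mulrA -idem_pev -mulrA pevX2_idem mulr0.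
- by rewrite mulrA pevX2_idem mul0r.
apply/negP; rewrite (cas_eq p2 q_prim) => h.
have [ik jl] := linked_weights p0 i2 k2 ji lk dw h.
by rewrite ik jl !eqxx in neq.
Qed.

(** The complement u is killed by every idempotent, and each P_n u is shown to vanish because E^p
    F^p P_n u = 0. *)
Lemma sum_idem : \sum_(i < 2 * p) \sum_(j < sdim i) idem i j = 1.
Proof.
pose u := 1 - \sum_(i < 2 * p) \sum_(j < sdim i) idem i j.
suff u0 : u = 0 by apply/esym/subr0_eq.
have idem_u i j : (i < 2 * p)%N -> (j < sdim i)%N -> idem i j * u = 0.
  move=> i2 ji; rewrite mulrBr mulr1 mulr_sumr.
  rewrite (bigD1 (Ordinal i2))//= [X in _ - (_ + X)]big1 ?addr0; last first.
    move=> k ki; rewrite mulr_sumr big1// => l _.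
    apply: idem_orthogonal => //.
    apply/orP; left; apply: contraNneq ki => ik.
    by apply/eqP/val_inj.
  rewrite mulr_sumr (bigD1 (Ordinal ji))//= big1 ?addr0; last first.
    move=> l lj; apply: idem_orthogonal => //.
    apply/orP; right; apply: contraNneq lj => jl.
    by apply/eqP/val_inj.
  by rewrite idemP subrr.
rewrite -[u]mul1r -sum_wproj mulr_suml big1// => n _.
(* [Hpol] is 1 modulo X^2: a vector killed by Cas - c and by H (Cas - c)
   vanishes, so the factors of E^p F^p = 0 can be removed one at a time. *)
have peel k (v : A) : (k < p)%N ->
    (forall i j, (i < 2 * p)%N -> (j < sdim i)%N ->
      ((2 * p)%:Z %| wt i j - n%:Z)%Z -> pev (ci i) (Hpol i) * v = 0) ->
    (Cas - (cas q (n%:Z - 1 - (k * 2)%:Z))%:A) * v = 0 -> v = 0.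
  move=> kp Hv xv.
  have [i [j [i2 ji dw]]] := weight_in_chain p0 (ltn_ord n) kp.
  rewrite -(cas_eq p2 q_prim) => /eqP ciE.
  rewrite -(Hv i j)// pev_Hpol_idem// expr2 pevM horner_algX -mulrA.
  by rewrite ciE xv mulr0.
pose M m : {poly C} :=
  \prod_(0 <= k < m) ('X + (0 - cas q (n%:Z - 1 - (k * 2)%:Z))%:P).
suff MP m : (m <= p)%N -> pev 0 (M m) * (wproj n * u) = 0 -> wproj n * u = 0.
  apply: (MP p) => //.
  by rewrite mulrA -EXFX_wproj Uq_EXp !mul0r.
elim: m => [|m IH] mp; first by rewrite /M big_geq// rmorph1 mul1r.
rewrite /M big_nat_recr//= -/(M m) pevMC pevXD0 -mulrA => h.
apply: IH; first exact: ltnW.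
apply: (peel m) => // i j i2 ji dw.
rewrite mulrA -comm_pev; last by apply/esym/comm_pev.
rewrite -mulrA [pev (ci i) _ * _]mulrA -(wproj_eq dw) -/(idem i j).
by rewrite idem_u// mulr0.
Qed.

(** * Isomorphisms between the weights of one simple module *)

Lemma E_idem i j : E * idem i j.+1 = idem i j * E.
Proof.
rewrite /idem mulrA comm_pev ?E_Cas// -!mulrA E_wproj; congr (_ * (wproj _ * _)).
rewrite /wt; lia.
Qed.

Lemma F_idem i j : F * idem i j = idem i j.+1 * F.
Proof.
rewrite /idem mulrA comm_pev ?F_Cas// -!mulrA F_wproj; congr (_ * (wproj _ * _)).
rewrite /wt; lia.
Qed.

Lemma EF_idem i j :
  E * F * idem i j = pev (ci i) ('X + (beta i j.+1)%:P) * idem i j.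
Proof.
have := cas_wt i j 0; rewrite addn0 subr0 => <-.
by rewrite pevXD0 -wproj_idem_l mulrA EF_wproj -mulrA.
Qed.

Lemma FE_idem i j :
  F * E * idem i j.+1 = pev (ci i) ('X + (beta i j.+1)%:P) * idem i j.+1.
Proof.
have := cas_wt i j 0; rewrite addn0 subr0 => <-.
have -> : wt i j - 1 = wt i j.+1 + 1 by rewrite /wt; lia.
by rewrite pevXD0 -wproj_idem_l mulrA FE_wproj -mulrA.
Qed.

(** Going down by F and back by E multiplies by x + [beta i j.+1], a unit on the idempotent since x
    is nilpotent there and [beta] is nonzero strictly inside the module. *)
Lemma idem_equiv_succ i j : (j.+1 < sdim i)%N ->
  equiv_idem (idem i j) (idem i j.+1).
Proof.
move=> ji; set b := beta i j.+1.
have b0 : b != 0.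
  rewrite beta_eq0; first by rewrite ltn_eqF.
  by have := sdim_le p0 i; lia.
(* The inverse of X + b modulo X^2, put on one side only of the equivalence. *)
pose v := b ^- 2 *: (b%:P - 'X).
have inv k : pev (ci i) ('X + b%:P) * (pev (ci i) v * idem i k) = idem i k.
  rewrite mulrA -pevM /v -scalerAr.
  have -> : ('X + b%:P) * (b%:P - 'X) = (b ^+ 2)%:P - 'X^2 :> {poly C}.
    by rewrite rmorphXn /=; ring.
  rewrite pevZ rmorphB /= horner_algC -scalerAl mulrBl pevX2_idem subr0.
  by rewrite -scalerAl mul1r scalerA mulVf ?expf_neq0// scale1r.
have Fv x : F * (pev (ci i) v * x) = pev (ci i) v * (F * x).
  by rewrite mulrA comm_pev ?F_Cas// mulrA.
have FEf : F * idem i j * (E * idem i j.+1)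
    = pev (ci i) ('X + b%:P) * idem i j.+1.
  rewrite -mulrA [idem i j * (E * _)]mulrA -E_idem -[E * _ * _]mulrA idemP mulrA.
  exact: FE_idem.
have EFe : E * idem i j.+1 * (F * idem i j)
    = pev (ci i) ('X + b%:P) * idem i j.
  rewrite -mulrA [idem i j.+1 * (F * _)]mulrA -F_idem -[F * _ * _]mulrA idemP mulrA.
  exact: EF_idem.
exists (E * idem i j.+1), (F * (pev (ci i) v * idem i j)); split.
- by rewrite -mulrA idemP.
- by rewrite -mulrA -[pev _ _ * _ * _]mulrA idemP.
- have Ev x : E * idem i j.+1 * (pev (ci i) v * x)
      = pev (ci i) v * (E * idem i j.+1 * x).
    rewrite mulrA -[E * _ * pev _ _]mulrA idem_pev [E * _]mulrA.
    by rewrite comm_pev ?E_Cas// -!mulrA.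
  by rewrite Fv Ev EFe mulrA -pevM pevMC -mulrA inv.
- by rewrite Fv -mulrA FEf mulrA -pevM pevMC -mulrA inv.
Qed.

Lemma idem_equiv i j k : (j < sdim i)%N -> (k < sdim i)%N ->
  equiv_idem (idem i j) (idem i k).
Proof.
have equiv0 l : (l < sdim i)%N -> equiv_idem (idem i 0) (idem i l).
  elim: l => [|l IH] li; first exact/equiv_idem_refl/idemP.
  apply: (equiv_idem_trans (IH (ltnW li))); exact: idem_equiv_succ.
move=> ji ki; apply: (@equiv_idem_trans _ (idem i 0)).
  exact/equiv_idem_sym/equiv0.
exact: equiv0.
Qed.

Lemma idem_iso i j k : (j < sdim i)%N -> (k < sdim i)%N ->
  lmod_isomorphic (left_ideal (idem i j)) (left_ideal (idem i k)).
Proof.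
move=> ji ki; apply: equiv_idem_iso (idem_equiv ji ki); exact: idemP.
Qed.

(** * Spanning family, primitivity and finite dimension *)

(* E, F and K generate A. *)
Hypothesis gen : forall J : A -> Prop, J 1 ->
  (forall x y, J x -> J y -> J (x + y)) -> (forall c x, J x -> J (c *: x)) ->
  (forall x, J x -> J (E * x)) -> (forall x, J x -> J (F * x)) ->
  (forall x, J x -> J (K * x)) -> forall x, J x.

(* A is spanned by the products of a polynomial in Cas, a power of E or of F,
   and a weight projection. *)
Lemma triangular_ind (S : A -> Prop) : S 0 ->
  (forall x y, S x -> S y -> S (x + y)) ->
  (forall g k z, (k < p)%N -> S (pev 0 g * (E ^+ k * wproj z))) ->
  (forall g k z, (k < p)%N -> S (pev 0 g * (F ^+ k * wproj z))) ->
  forall x, S x.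
Proof.
move=> S0 SD SE SF x.
(* The span of the words ending in a fixed P_z, which left multiplication preserves. It is encoded
   by its induction principle, so that closure under a generator follows by a suitable choice of
   R. *)
pose T (z : int) (y : A) := forall R : A -> Prop, R 0 ->
  (forall x y, R x -> R y -> R (x + y)) ->
  (forall g k, (k < p)%N -> R (pev 0 g * (E ^+ k * wproj z))) ->
  (forall g k, (k < p)%N -> R (pev 0 g * (F ^+ k * wproj z))) -> R y.
have T0 z : T z 0 by move=> R.
have TD z y y' : T z y -> T z y' -> T z (y + y').
  by move=> Ty Ty' R R0 RD RE RF; exact: RD (Ty R R0 RD RE RF) (Ty' R R0 RD RE RF).
have TE z g k : (k < p)%N -> T z (pev 0 g * (E ^+ k * wproj z)).
  by move=> kp R R0 RD RE RF; apply: RE.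
have TF z g k : (k < p)%N -> T z (pev 0 g * (F ^+ k * wproj z)).
  by move=> kp R R0 RD RE RF; apply: RF.
have mulT (a : A) z :
    (forall g k, (k < p)%N -> T z (a * (pev 0 g * (E ^+ k * wproj z)))) ->
    (forall g k, (k < p)%N -> T z (a * (pev 0 g * (F ^+ k * wproj z)))) ->
    forall y, T z y -> T z (a * y).
  move=> aE aF y Ty; apply: (Ty (fun y => T z (a * y))) => //; first by rewrite mulr0.
  by move=> y1 y2 T1 T2; rewrite mulrDr; apply: TD.
have stepE z (g : {poly C}) k (a : A) : a * Cas = Cas * a ->
  a * (pev 0 g * (E ^+ k * wproj z)) = pev 0 g * (a * (E ^+ k * wproj z)).
  by move=> aC; rewrite [LHS]mulrA (comm_pev _ _ aC) -mulrA.
have stepF z (g : {poly C}) k (a : A) : a * Cas = Cas * a ->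
  a * (pev 0 g * (F ^+ k * wproj z)) = pev 0 g * (a * (F ^+ k * wproj z)).
  by move=> aC; rewrite [LHS]mulrA (comm_pev _ _ aC) -mulrA.
have pevA g (a : C) y : pev 0 g * ((Cas - a%:A) * y)
    = pev 0 (g * ('X - a%:P)) * y.
  by rewrite pevM -polyCN pevXD sub0r opprK mulrA.
suff Tx z : T z (x * wproj z).
  rewrite -[x]mulr1 -sum_wproj mulr_sumr; elim/big_ind: _ => // n _.
  by apply: Tx => // g k kp; [apply: SE | apply: SF].
move: x z; apply: gen => [z|x y Tx Ty z|c x Tx z|x Tx z|x Tx z|x Tx z].
- by have := TE z 1 0%N p0; rewrite rmorph1 !mul1r.
- by rewrite mulrDl; apply: TD.
- rewrite -scalerAl; have -> : c *: (x * wproj z) = c%:A * (x * wproj z).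
    by rewrite -scalerAl mul1r.
  apply: mulT (Tx z) => g k kp; rewrite mulrA -scalerAl mul1r -pevZ.
    exact: TE.
  exact: TF.
- rewrite -mulrA; apply: mulT (Tx z) => g k kp.
    rewrite stepE ?E_Cas// [E * (_ * _)]mulrA -exprS.
    have [kp1|] := ltnP k.+1 p; first exact: TE.
    move=> pk; have -> : k.+1 = p by lia.
    by rewrite Uq_EXp mul0r mulr0; apply: T0.
  rewrite stepF ?E_Cas//; case: k kp => [|k] kp.
    by have := TE z g 1%N p2; rewrite mul1r expr1.
  (* The leading E F meets F^k P_z, which has a definite weight: it becomes a linear polynomial in
     [Cas], and the exponent drops by one. *)
  rewrite exprS -[F * _ * _]mulrA [E * (F * _)]mulrA.
  rewrite FX_wproj [E * F * _]mulrA EF_wproj -[_ * _ * F ^+ k]mulrA -FX_wproj.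
  by rewrite pevA; apply: TF; exact: ltnW.
- rewrite -mulrA; apply: mulT (Tx z) => g k kp; last first.
    rewrite stepF ?F_Cas// [F * (_ * _)]mulrA -exprS.
    have [kp1|] := ltnP k.+1 p; first exact: TF.
    move=> pk; have -> : k.+1 = p by lia.
    by rewrite Uq_FXp mul0r mulr0; apply: T0.
  rewrite stepE ?F_Cas//; case: k kp => [|k] kp.
    by have := TF z g 1%N p2; rewrite mul1r expr1.
  rewrite exprS -[E * _ * _]mulrA [F * (E * _)]mulrA.
  rewrite EX_wproj [F * E * _]mulrA FE_wproj -[_ * _ * E ^+ k]mulrA -EX_wproj.
  by rewrite pevA; apply: TE; exact: ltnW.
- rewrite -mulrA; apply: mulT (Tx z) => g k kp.
    rewrite stepE ?K_Cas// EX_wproj [K * _]mulrA K_wproj -scalerAl -EX_wproj.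
    by rewrite -scalerAr scalerAl -pevZ; apply: TE.
  rewrite stepF ?K_Cas// FX_wproj [K * _]mulrA K_wproj -scalerAl -FX_wproj.
  by rewrite -scalerAr scalerAl -pevZ; apply: TF.
Qed.

(** For 0 < k < p, E^k and F^k shift weights by 2k in absolute value, which is nonzero modulo 2p, so
    only k = 0 survives between two copies of P_w. *)
Lemma wproj_sandwich w x : exists g, wproj w * x * wproj w = pev 0 g * wproj w.
Proof.
have corner (X : A) (m : int) g k z :
    (forall z, X * wproj z = wproj (z + m) * X) ->
    (m = 0 -> X = 1) -> (m = (k * 2)%:Z \/ m = - (k * 2)%:Z) -> (k < p)%N ->
    exists h, wproj w * (pev 0 g * (X * wproj z)) * wproj w = pev 0 h * wproj w.
  move=> XP X1 mk kp.
  rewrite mulrA wproj_pev -!mulrA wproj_mul.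
  case: ifP => _; last by exists 0; rewrite !mulr0 rmorph0 mul0r.
  rewrite XP [wproj w * _]mulrA wproj_mul.
  case: ifP => [h|_]; last by exists 0; rewrite mul0r mulr0 rmorph0 mul0r.
  have m0 : m = 0.
    have : ((2 * p)%:Z %| m)%Z by rewrite dvdz_subC addrC addKr in h.
    by move/dvd2p_eq0; case: mk => ->; lia.
  by exists g; rewrite (X1 m0) m0 addr0 mulr1.
move: x; apply: triangular_ind => [|x y [g gE] [h hE]|g k z kp|g k z kp].
- by exists 0; rewrite mulr0 mul0r rmorph0 mul0r.
- by exists (g + h); rewrite mulrDr mulrDl gE hE rmorphD mulrDl.
- apply: (@corner _ (k * 2)%:Z _ k) => //; last by left.
    exact: EX_wproj.
  by case: k kp => // k; lia.
- apply: (@corner _ (- (k * 2)%:Z) _ k) => //; last by right.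
    exact: FX_wproj.
  by case: k kp => // k; lia.
Qed.

(** Since x^2 = 0 on the idempotent, only the Taylor expansion of order 1 at its eigenvalue is
    left. *)
Lemma pev_idem i j g : exists a b,
  pev 0 g * idem i j = a *: idem i j + b *: ((Cas - (ci i)%:A) * idem i j).
Proof.
elim/poly_ind: g => [|g c [a [b IH]]].
  by exists 0, 0; rewrite rmorph0 mul0r !scale0r addr0.
have xi2 : (Cas - (ci i)%:A) * ((Cas - (ci i)%:A) * idem i j) = 0.
  by have := pevX2_idem i j; rewrite expr2 pevM horner_algX mulrA.
exists (c + ci i * a), (a + ci i * b).
rewrite rmorphD /= horner_algC mulrDl pevMC -mulrA IH horner_algX.
rewrite scale0r subr0 -[X in X * _](subrK (ci i)%:A) mulrDl mulrDr -!scalerAr xi2.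
rewrite scaler0 addr0 -!scalerAl !mul1r scalerDr !scalerA !scalerDl.
by rewrite [LHS]addrC -[RHS]addrA; congr (_ + _); rewrite addrCA.
Qed.

(** The corner e A e consists of the elements a e + b y with y^2 = 0. For a summand f of e, either a
    = 1, and then g is a multiple of y, hence nilpotent and zero, or f itself is zero. *)
Lemma idem_primitive i j : idem i j <> 0 -> primitive_idempotent (idem i j).
Proof.
move=> e0; split=> //; first exact: idemP.
set e := idem i j => f g ff gg [fg gf] efg.
have ef : e * f = f by rewrite efg mulrDl ff gf addr0.
have fe : f * e = f by rewrite efg mulrDr ff fg addr0.
pose y := (Cas - (ci i)%:A) * e.
have ee : e * e = e by exact: idemP.
have yy : y * y = 0.
  rewrite /y -mulrA [e * _]mulrA.
  have -> : e * (Cas - (ci i)%:A) = (Cas - (ci i)%:A) * e.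
    by have := idem_pev (ci i) 'X i j; rewrite horner_algX.
  rewrite -[_ * e * e]mulrA ee.
  by have := pevX2_idem i j; rewrite expr2 pevM horner_algX mulrA.
have [a [b fE]] : exists a b, f = a *: e + b *: y.
  have [h hE] := wproj_sandwich (wt i j) f.
  have [a [b abE]] := pev_idem i j h.
  have assoc (u v w : A) : u * v * w * (v * u) = u * (v * w * v) * u.
    by rewrite !mulrA.
  have eP : e * wproj (wt i j) = e := idem_wproj i j.
  have Pe : wproj (wt i j) * e = e := wproj_idem_l i j.
  have eh : e * pev 0 h = pev 0 h * e := idem_pev 0 h i j.
  exists a, b; rewrite /y -abE -/e.
  have -> : f = e * wproj (wt i j) * f * (wproj (wt i j) * e).
    by rewrite eP Pe ef fe.
  by rewrite assoc hE [e * _]mulrA eh -mulrA -mulrA Pe ee.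
have sq : (f - a *: e) * (f - a *: e) = 0.
  by rewrite fE addrC addKr -scalerAl -scalerAr yy !scaler0.
have [a1|a1] := eqVneq a 1.
  right; have gE : g = - b *: y.
    by rewrite -[g](addKr f) -efg fE a1 scale1r opprD addrAC addNr add0r scaleNr.
  by rewrite -gg gE -scalerAl -scalerAr yy !scaler0.
(* Applied twice this gives (1 - a)^2 f = f (f - a e)^2 = 0. *)
have h : f * (f - a *: e) = (1 - a) *: f.
  by rewrite mulrBr ff -scalerAr fe scalerBl scale1r.
left; apply/eqP; have : (1 - a) *: ((1 - a) *: f) == 0.
  by rewrite -{1}h scalerAl -h -mulrA sq mulr0.
by rewrite !scaler_eq0 subr_eq0 eq_sym (negbTE a1).
Qed.

Lemma finite_dimensionalP (T : finType) (b : T -> A) :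
  (forall x, exists c : T -> C, x = \sum_t c t *: b t) -> finite_dimensional A.
Proof.
move=> bP; exists #|T|, (b \o enum_val) => x.
have [c ->] := bP x; exists (c \o enum_val).
by rewrite -(big_enum_val (fun t => c t *: b t)).
Qed.

(** E^p F^p = 0 provides a monic polynomial of degree p that kills P_w; r is the remainder of g. *)
Lemma pev_wproj_small g w : exists r : {poly C},
  (size r <= p)%N /\ pev 0 g * wproj w = pev 0 r * wproj w.
Proof.
pose M : {poly C} :=
  \prod_(0 <= k < p) ('X + (0 - cas q (w - 1 - (k * 2)%:Z))%:P).
have MP : pev 0 M * wproj w = 0 by rewrite -EXFX_wproj Uq_EXp !mul0r.
have sM : size M = p.+1.
  rewrite /M (eq_bigr (fun k => 'X - (cas q (w - 1 - (k * 2)%:Z))%:P)).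
    by rewrite size_prod_XsubC size_iota subn0.
  by move=> k _; rewrite sub0r polyCN.
exists (g %% M); split.
  by rewrite -ltnS -sM ltn_modp -size_poly_eq0 sM.
rewrite {1}(divp_eq g M) rmorphD /= mulrDl pevM -mulrA MP mulr0 add0r.
by [].
Qed.

Lemma Uq_finite_dimensional : finite_dimensional A.
Proof.
pose b (t : bool * 'I_(2 * p) * 'I_p * 'I_p) : A :=
  let: (s, n, k, m) := t in
  Cas ^+ m * ((if s then E else F) ^+ k * wproj n%:Z).
apply: (@finite_dimensionalP _ b).
pose S x := exists c : _ -> C, x = \sum_t c t *: b t.
have S0 : S 0 by exists (fun=> 0); rewrite big1// => t _; rewrite scale0r.
have SD x y : S x -> S y -> S (x + y).
  move=> [c ->] [d ->]; exists (fun t => c t + d t).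
  by rewrite -big_split; apply: eq_bigr => t _; rewrite scalerDl.
have SZb a t : S (a *: b t).
  exists (fun u => if u == t then a else 0).
  rewrite (bigD1 t)//= eqxx big1 ?addr0// => u /negbTE ->.
  by rewrite scale0r.
have zn z : exists n : 'I_(2 * p), wproj z = wproj n%:Z.
  have n2 : (`|(z %% (2 * p)%:Z)%Z|%N < 2 * p)%N.
    by rewrite -ltz_nat gez0_abs ?modz_ge0 ?ltz_pmod//; lia.
  exists (Ordinal n2); apply: wproj_eq; rewrite /= gez0_abs; last first.
    by rewrite modz_ge0//; lia.
  by rewrite {1}(divz_eq z (2 * p)%:Z) addrK dvdz_mull.
have Sg s n k w g (X := if s then E else F) : (k < p)%N ->
    X ^+ k * wproj (n : 'I_(2 * p))%:Z = wproj w * X ^+ k ->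
    S (pev 0 g * (X ^+ k * wproj n%:Z)).
  move=> kp XP; have [r [rp rE]] := pev_wproj_small g w.
  rewrite XP mulrA rE -mulrA -XP -[r]coefK poly_def raddf_sum mulr_suml.
  elim/big_ind: _ => // m _.
  have mp : (m < p)%N by apply: leq_trans rp; exact: ltn_ord.
  rewrite /= pevZ rmorphXn /= horner_algX scale0r subr0 -scalerAl.
  exact: (SZb _ (s, n, Ordinal kp, Ordinal mp)).
move=> x; apply: (triangular_ind S0 SD) => g k z kp.
  have [n ->] := zn z; apply: (Sg true) => //; exact: EX_wproj.
have [n ->] := zn z; apply: (Sg false) => //; exact: FX_wproj.
Qed.

(** The morphism will be the action on X_i. It is postponed because its properties rest on the
    identities above, applied to matrices. *)
Hypothesis separating : forall i k l, (i < 2 * p)%N -> (k < 2 * p)%N ->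
  (l < sdim k)%N -> i != k -> exists (B : nzRingType) (rho : {rmorphism A -> B}),
    rho (idem i 0) != 0 /\ rho (idem k l) = 0.

Lemma idem_neq0 i j : (i < 2 * p)%N -> (j < sdim i)%N -> idem i j <> 0.
Proof.
move=> i2 ji e0.
(* Any k other than i will do: it only serves to obtain [rho]. *)
have [k [k2 ik]] : exists k, (k < 2 * p)%N /\ i != k.
  have [->|i0] := eqVneq i 0%N; first by exists 1%N; split => //; lia.
  by exists 0%N; split => //; lia.
have [B [rho [rho0 _]]] := separating i2 k2 (ltn0Sn _) ik.
have [a [b [_ be _ baE]]] := @idem_equiv i j 0 ji (ltn0Sn _).
by move: rho0; rewrite -baE -be e0 mulr0 mul0r rmorph0 eqxx.
Qed.

Lemma idem_not_iso i j k l : (i < 2 * p)%N -> (k < 2 * p)%N ->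
  (j < sdim i)%N -> (l < sdim k)%N -> i != k ->
  ~ lmod_isomorphic (left_ideal (idem i j)) (left_ideal (idem k l)).
Proof.
move=> i2 k2 ji lk ik /(left_ideal_isoW (idemP i j) (idemP k l)) [c [d ecd]].
have [B [rho [rho0 rhof]]] := separating i2 k2 lk ik.
have [a [b [_ be _ baE]]] := @idem_equiv i j 0 ji (ltn0Sn _).
have rho_cd : rho (c * idem k l * d) = 0.
  by rewrite rmorphM rmorphM rhof mulr0 mul0r.
move: rho0; rewrite -baE -be ecd.
by rewrite rmorphM rmorphM rho_cd mulr0 mul0r eqxx.
Qed.

Lemma idem_is_basic_set :
  is_basic_set [set x : A | exists2 i, (i < 2 * p)%N & x = idem i 0].
Proof.
split; first exact: Uq_finite_dimensional.
exists (2 * p)%N, (fun i => sdim i), (fun i j => idem i j), (fun i => ord0).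
split.
- exact/esym/sum_idem.
- by move=> i j; apply/idem_primitive/idem_neq0.
- move=> i j k l neq; split; apply: idem_orthogonal => //.
  by case/orP: neq => h; apply/orP; [left | right]; rewrite eq_sym.
- split=> [i j k|i j k l ik]; first exact: idem_iso.
  exact: idem_not_iso.
apply/seteqP; split=> x /=.
  by case=> i i2 ->; exists (Ordinal i2).
by case=> i ->; exists i => //=.
Qed.

(** Replacing the factors X + b_k by b_k one at a time from the top, each step costs a term with X
    in place of the factor. This is where the coefficients [alpha_] of [b0_] come from. *)
Lemma telescoping_prod (r : nat) (b : nat -> C) : (0 < r)%N ->
  \sum_(1 <= n < r) (\prod_(r - n.-1 <= k < r) b k)
    *: ('X * \prod_(1 <= k < r - n) ('X + (b k)%:P))
  + (\prod_(1 <= k < r) b k)%:P = \prod_(1 <= k < r) ('X + (b k)%:P).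
Proof.
move=> r0.
pose U n : {poly C} := (\prod_(r - n.-1 <= k < r) b k)
  *: \prod_(1 <= k < r - n.-1) ('X + (b k)%:P).
rewrite (eq_big_nat _ _ (F2 := fun n => - (U n.+1 - U n))); last first.
  move=> n /andP[n1 nr]; rewrite opprB /U /=.
  have rn : (r - n.-1 = (r - n).+1)%N by lia.
  rewrite rn [\prod_(1 <= k < (r - n).+1) _]big_nat_recr/=; last lia.
  rewrite (big_ltn (_ : r - n < r)%N); last lia.
  set x := \prod_(_ <= _ < r - n) _; set y := \prod_(_ <= _ < r) _.
  by rewrite -!mul_polyC rmorphM /=; ring.
rewrite sumrN telescope_sumr// opprB /U /= subn0 [\prod_(r <= _ < r) _]big_geq//.
rewrite scale1r -{1}(subn0 r) subn0.
have -> : (r - r.-1 = 1)%N by lia.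
by rewrite [\prod_(1 <= _ < 1) _]big_geq// alg_polyC subrK.
Qed.

(** * Comparison with the explicit formulas *)

Section Formula.
Variables (b : bool) (s : nat).
Hypotheses (s0 : (0 < s)%N) (sp : (s <= p)%N).

Let i := (b * p + s.-1)%N.

Lemma sdim_formula : sdim i = s.
Proof. by rewrite /sdim /i modnMDl modn_small ?prednK//; lia. Qed.

Lemma br_pm a : br q (a + (b * p)%:Z) = pm C b * br q a.
Proof.
by rewrite /pm; case: b; rewrite ?mul1n ?mul0n ?(br_addp p2 q_prim) ?addr0
  ?expr0 ?expr1 ?mulN1r ?mul1r.
Qed.

(** With [beta_gt], this identifies both families of factors in the formulas as values of [beta],
    below and above s; the sign is that of the shift by p. *)
Lemma beta_lt k : (0 < k < s)%N ->
  beta i k = pm C b * qint q k * qint q (s - k).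
Proof.
move=> ks; rewrite /beta -!(brE q).
have -> : i.+1%:Z - k%:Z = (s - k)%:Z + (b * p)%:Z by rewrite /i; lia.
by rewrite br_pm mulrCA mulrA.
Qed.

Lemma beta_gt k : (0 < k < p - s)%N ->
  beta i (s + k) = - pm C b * qint q k * qint q (p - s - k).
Proof.
move=> ks; rewrite /beta -!(brE q).
have -> : i.+1%:Z - (s + k)%N%:Z = - k%:Z + (b * p)%:Z by rewrite /i; lia.
rewrite br_pm brN -(br_psub p2 q_prim).
have -> : p%:Z - (s + k)%N%:Z = (p - s - k)%N%:Z by lia.
by ring.
Qed.

Lemma v_wproj : v_ q p K b s = (2 * p)%:R *: wproj (wt i 0).
Proof.
rewrite /v_ /wproj scalerA divff// scale1r; apply: eq_bigr => l _.
congr (_ ^+ _ *: _); rewrite /wt subr0 -invr_expz -exprnP /i exprD mulnC exprM.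
rewrite (q_expp p2 q_prim) /pm invfM; congr (_ * _).
by case: b; rewrite ?expr1 ?expr0 ?invr1// invrN1.
Qed.

Lemma EXFX_v m : E ^+ m * F ^+ m * v_ q p K b s
  = (2 * p)%:R *: (pev (ci i) (\prod_(1 <= k < m.+1) ('X + (beta i k)%:P))
                   * wproj (wt i 0)).
Proof.
rewrite v_wproj -scalerAr (EXFX_wproj _ _ (ci i)) big_add1 /=.
by congr (_ *: (pev _ _ * _)); apply: eq_bigr => k _; rewrite cas_wt add0n.
Qed.

Local Notation Lo := (\prod_(1 <= k < s) ('X + (beta i k)%:P)).
Local Notation Hi r := (\prod_(1 <= k < r) ('X + (beta i (s + k))%:P)).

Lemma Dpol_LoHi : Dpol i = Lo * Hi (p - s)%N.
Proof.
rewrite /Dpol sdim_formula; have [ps|ps] := eqVneq s p.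
  rewrite [X in _ * X]big_geq ?mulr1; last lia.
  rewrite -ps [LHS]big_nat_cond [RHS]big_nat_cond; apply: eq_bigl => k.
  by apply/andb_id2l => /andP[_ ks]; lia.
have sp' : (s < p)%N by lia.
rewrite (big_cat_nat _ (n := s))//= [X in _ * X]big_ltn_cond// eqxx /=.
congr (_ * _).
  rewrite [LHS]big_nat_cond [RHS]big_nat_cond; apply: eq_bigl => k.
  by apply/andb_id2l => /andP[_ ks]; lia.
rewrite -[s.+1]add1n big_addn; rewrite [LHS]big_nat_cond [RHS]big_nat_cond.
apply: eq_big => [k|k _]; last by rewrite addnC.
by apply/andb_id2l => /andP[k1 _]; lia.
Qed.

Lemma prod_LoXHi m : (s <= m)%N ->
  \prod_(1 <= k < m.+1) ('X + (beta i k)%:P) = Lo * ('X * Hi (m.+1 - s)%N).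
Proof.
move=> sm; rewrite (big_cat_nat _ (n := s))//=; last by rewrite ltnW.
congr (_ * _); rewrite big_ltn// -sdim_formula beta_sdim addr0 sdim_formula.
congr (_ * _); rewrite -[s.+1]add1n big_addn.
by apply: eq_bigr => k _; rewrite addnC.
Qed.

Lemma prod_Lo (P : pred nat) :
  \prod_(1 <= k < s | P k) (pm C b * qint q k * qint q (s - k))
  = \prod_(1 <= k < s | P k) beta i k.
Proof.
rewrite big_nat_cond [RHS]big_nat_cond; apply: eq_bigr => k /andP[ks _].
by rewrite beta_lt.
Qed.

Lemma prod_Hi m (P : pred nat) : (0 < m)%N ->
  \prod_(m <= k < p - s | P k) (- pm C b * qint q k * qint q (p - s - k))
  = \prod_(m <= k < p - s | P k) beta i (s + k).
Proof.
move=> m0; rewrite big_nat_cond [RHS]big_nat_cond.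
apply: eq_bigr => k /andP[/andP[mk kp] _].
by rewrite beta_gt// kp andbT (leq_trans m0).
Qed.

Lemma gamma_Dpol : gamma_ q p b s = (2 * p)%:R * (Dpol i)`_0.
Proof.
rewrite Dpol_LoHi coef0M !coef0_prod_XaddC /gamma_ prod_Lo prod_Hi//.
by rewrite mulrAC mulrA.
Qed.

Lemma delta_Dpol : delta_ q p b s = (2 * p)%:R * (Dpol i)`_1.
Proof.
rewrite Dpol_LoHi coefM !big_ord_recl big_ord0 /= addr0 subn0.
rewrite !coef0_prod_XaddC !coef1_prod_XaddC ?iota_uniq// /delta_ prod_Lo prod_Hi//.
under [X in _ * X + _ = _]eq_bigr do rewrite prod_Lo.
under [X in _ + _ * X = _]eq_bigr do rewrite prod_Hi//.
by rewrite mulrDr !mulrA [LHS]addrC; congr (_ + _); rewrite mulrAC.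
Qed.

Lemma b0_Dpol : (s < p)%N ->
  b0_ q p E F K b s = (2 * p)%:R *: (pev (ci i) (Dpol i) * wproj (wt i 0)).
Proof.
move=> sp'; have r0 : (0 < p - s)%N by lia.
rewrite Dpol_LoHi -(telescoping_prod (fun k => beta i (s + k)) r0).
rewrite mulrDr pevD mulrDl scalerDr mulr_sumr pev_sum mulr_suml scaler_sumr.
(* The last summand is the constant term of the telescoping: E^(s-1) F^(s-1) only involves the
   factors below s, hence no X. *)
rewrite /b0_ big_nat_recr//=; congr (_ + _).
  rewrite big_nat_cond [RHS]big_nat_cond; apply: eq_bigr => n /andP[/andP[n1 nr] _].
  rewrite /alpha_ prod_Hi; last lia.
  rewrite EXFX_v prod_LoXHi; last lia.
  have -> : ((p.-1 - n).+1 - s = p - s - n)%N by lia.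
  by rewrite -[Lo * (_ *: _)]scalerAr pevZ -scalerAl scalerA mulrC -scalerA.
rewrite /alpha_ prod_Hi; last lia.
rewrite EXFX_v.
have -> : ((p.-1 - (p - s)).+1 = s)%N by lia.
have -> : (p - s - (p - s).-1 = 1)%N by lia.
by rewrite [Lo * _]mulrC mul_polyC pevZ -scalerAl !scalerA mulrC.
Qed.

Lemma a0_Dpol : (s < p)%N ->
  a0_ q p E F K b s
  = (2 * p)%:R *: (pev (ci i) ('X * Dpol i) * wproj (wt i 0)).
Proof.
move=> sp'; rewrite /a0_ EXFX_v prod_LoXHi; last lia.
by rewrite prednK// Dpol_LoHi mulrCA.
Qed.

Lemma e_idem : e_ q p E F K b s = idem i 0.
Proof.
have g0 := Dpol0_neq0 i.
have HpolZ : pev (ci i) (Hpol i) = ((Dpol i)`_0)^-1 *: pev (ci i) (Dpol i)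
    - ((Dpol i)`_1 / (Dpol i)`_0 ^+ 2) *: pev (ci i) ('X * Dpol i).
  rewrite -!pevZ -pevB; congr (pev _ _); rewrite /Hpol.
  move: (Dpol i)`_0 (Dpol i)`_1 g0 => a d a0.
  have -> : a^-1 = a ^- 2 * a by field.
  by move: (a ^- 2) => c; rewrite -!mul_polyC !polyCM; ring.
rewrite /e_ /idem; case: eqP => [ps|/eqP ps]; last first.
  have sp' : (s < p)%N by lia.
  rewrite b0_Dpol// a0_Dpol// gamma_Dpol delta_Dpol HpolZ mulrBl -!scalerAl.
  rewrite !scalerBr !scalerA.
  move: (Dpol i)`_0 (Dpol i)`_1 (2 * p)%:R g0 char_2p => a d N a0 N0.
  by congr (_ *: _ - _ *: _); field; rewrite ?a0 ?N0.
(* For s = p the linear correction in H vanishes, which explains the shorter formula. *)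
have h : pev (ci i) ('X * Dpol i) * wproj (wt i 0) = 0.
  have := pev_prod_beta_wproj i 0; rewrite prod_beta sdim_formula ps ltnn.
  by rewrite mulr1.
have -> : \prod_(1 <= k < p) (pm C b * qint q k * qint q (p - k)) = (Dpol i)`_0.
  have := prod_Lo predT; rewrite ps => ->.
  rewrite Dpol_LoHi ps subnn [\prod_(1 <= _ < 0) _]big_geq// mulr1.
  by rewrite coef0_prod_XaddC.
have -> : a0_ q p E F K b p = a0_ q p E F K b s by rewrite ps.
rewrite /a0_ EXFX_v prednK//.
have -> : \prod_(1 <= k < p) ('X + (beta i k)%:P) = Dpol i.
  by rewrite Dpol_LoHi ps subnn [\prod_(1 <= _ < 0) _]big_geq// mulr1.
rewrite HpolZ mulrBl -!scalerAl h scaler0 subr0 !scalerA.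
move: (Dpol i)`_0 (2 * p)%:R g0 char_2p => a N a0 N0.
by congr (_ *: _); field; rewrite ?a0 ?N0.
Qed.

End Formula.

Lemma e_is_basic_set :
  is_basic_set [set x : A | exists (b : bool) (s : nat),
    (1 <= s <= p)%N /\ x = e_ q p E F K b s].
Proof.
suff <- : [set x : A | exists2 i, (i < 2 * p)%N & x = idem i 0]
    = [set x : A | exists (b : bool) (s : nat),
        (1 <= s <= p)%N /\ x = e_ q p E F K b s] by exact: idem_is_basic_set.
apply/seteqP; split=> x /=.
  case=> i i2 ->; exists (p <= i)%N, (sdim i); rewrite sdim_le//; split=> //.
  rewrite e_idem ?sdim_le//; congr (idem _ _).
  case: leqP => pi; first by rewrite sdim_ge ?pi//=; lia.
  by rewrite sdim_lt.
case=> b [s [/andP[s1 sp] ->]]; exists (b * p + s.-1)%N; last exact: e_idem.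
by case: b => /=; lia.
Qed.

End UqStructure.

(** * The simple modules as matrix representations *)

Section SimpleModules.
Variables (C : fieldType) (q : C) (p : nat).
Hypotheses (p2 : (2 <= p)%N) (q_prim : (2 * p).-primitive_root q).
Hypothesis char_2p : (2 * p)%:R != 0 :> C.

Let p0 : (0 < p)%N. Proof. exact: ltnW. Qed.
Let q0 : q != 0. Proof. exact: q_neq0 p2 q_prim. Qed.
Let d0 : q - q^-1 != 0. Proof. exact: q_subV_neq0 p2 q_prim. Qed.

Variable i : nat.
Hypothesis i2 : (i < 2 * p)%N.

Local Notation n := (i %% p)%N.

(** The action in the basis F^a v of X_i, with v a highest weight vector. The dimension is written
    as a successor so that the matrices form a nonzero ring. *)
Definition simpleE : 'M[C]_n.+1 :=
  \matrix_(a, b) (beta q i b *+ (a.+1 == b :> nat)).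
Definition simpleF : 'M[C]_n.+1 := \matrix_(a, b) (a == b.+1 :> nat)%:R.
Definition simpleK : 'M[C]_n.+1 := \matrix_(a, b) (q ^ wt i a *+ (a == b)).

Local Notation E := simpleE.
Local Notation F := simpleF.
Local Notation K := simpleK.
Local Notation Ki := (K ^+ (2 * p).-1).

Lemma simpleKX l a b : (K ^+ l) a b = (q ^ wt i a) ^+ l *+ (a == b).
Proof.
elim: l a b => [|l IH] a b; first by rewrite !expr0 mxE.
rewrite exprS mxE (bigD1 a)//= big1 ?addr0.
  by rewrite mxE eqxx IH exprS mulrnAr.
by move=> c ca; rewrite mxE eq_sym (negbTE ca) mul0r.
Qed.

Lemma simpleKi a b : Ki a b = q ^ (- wt i a) *+ (a == b).
Proof.
rewrite simpleKX; congr (_ *+ _).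
apply: (mulIf (expfz_neq0 (wt i a) q0)).
rewrite -exprSr prednK ?muln_gt0// exprz_q_X2p//.
by rewrite -invr_expz mulVf// expfz_neq0.
Qed.

Lemma simpleK_mul (X : 'M[C]_n.+1) a b : (K * X) a b = q ^ wt i a * X a b.
Proof.
rewrite mxE (bigD1 a)//= big1 ?addr0; first by rewrite mxE eqxx.
by move=> c ca; rewrite mxE eq_sym (negbTE ca) mul0r.
Qed.

Lemma mul_simpleKi (X : 'M[C]_n.+1) a b :
  (X * Ki) a b = X a b * q ^ (- wt i b).
Proof.
rewrite mxE (bigD1 b)//= big1 ?addr0; first by rewrite simpleKi eqxx.
by move=> c ca; rewrite simpleKi (negbTE ca) mulr0.
Qed.

Lemma simpleEF a b : (E * F) a b = beta q i a.+1 *+ (a == b).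
Proof.
rewrite mxE (eq_bigr (fun c : 'I_n.+1 =>
  if c == a.+1 :> nat then beta q i c *+ (a == b) else 0)); last first.
  move=> c _; rewrite !mxE [a.+1 == _]eq_sym.
  case: eqP => [ca|]; last by rewrite mul0r.
  by rewrite ca eqSS mulr1n mulr_natr.
rewrite -big_mkcond /= (big_ord1_eq _ (fun c => beta q i c *+ (a == b))).
(* At the last basis vector the index a + 1 leaves the module, but [beta] vanishes there. *)
case: ifPn => // an.
have -> : (a : nat).+1 = sdim p i by rewrite /sdim; have := ltn_ord a; lia.
by rewrite beta_sdim// mul0rn.
Qed.

Lemma simpleFE a b : (F * E) a b = beta q i a *+ (a == b).
Proof.
rewrite mxE (eq_bigr (fun c : 'I_n.+1 =>
  if c == a.-1 :> nat then beta q i a *+ (a == b) else 0)); last first.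
  (* For a = 0 the predecessor is truncated, which is harmless because [beta i 0 = 0]. *)
  move=> c _; rewrite !mxE; case: (posnP a) => [->|a1].
    by rewrite beta0 mul0rn mul0r; case: ifP.
  have -> : (a == c.+1 :> nat) = (c == a.-1 :> nat) by lia.
  case: eqP => [ca|]; last by rewrite mul0r.
  rewrite mul1r ca prednK// -val_eqE /=.
  by case: eqP => [->|].
rewrite -big_mkcond /= (big_ord1_eq _ (fun _ : nat => beta q i a *+ (a == b))).
by case: ifPn => //; have := ltn_ord a; lia.
Qed.

Lemma simpleEX k a b : (E ^+ k) a b != 0 -> (b = a + k :> nat)%N.
Proof.
elim: k a b => [|k IH] a b.
  by rewrite mxE addn0; case: (a =P b) => [->|] //; rewrite eqxx.
rewrite exprS mxE; apply: contra_neq_eq => ba.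
rewrite big1// => c _; rewrite mxE.
case: (a.+1 =P c) => [ac|_]; last by rewrite mulr0n mul0r.
apply/eqP; rewrite mulf_eq0; apply/orP; right.
by apply: contra_neqT ba => /IH ->; rewrite -ac addSnnS.
Qed.

Lemma simpleFX k a b : (F ^+ k) a b != 0 -> (a = b + k :> nat)%N.
Proof.
elim: k a b => [|k IH] a b.
  by rewrite mxE addn0; case: (a =P b) => [->|] //; rewrite eqxx.
rewrite exprS mxE; apply: contra_neq_eq => ba.
rewrite big1// => c _; rewrite mxE.
case: (a =P c.+1 :> nat) => [ac|_]; last by rewrite mul0r.
apply/eqP; rewrite mulf_eq0; apply/orP; right.
by apply: contra_neqT ba => /IH cb; rewrite ac cb addnS.
Qed.

Lemma beta_succ_sub a :
  beta q i a.+1 - beta q i a = (q - q^-1)^-1 * (q ^ wt i a - q ^ (- wt i a)).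
Proof.
rewrite /beta -!(cas_sub p2 q_prim).
have -> : i.+1%:Z - a.+1%:Z *+ 2 = wt i a - 1 by rewrite /wt; lia.
have -> : i.+1%:Z - a%:Z *+ 2 = wt i a + 1 by rewrite /wt; lia.
by rewrite opprB addrC addrA subrK (cas_add1_sub p2 q_prim).
Qed.

Lemma simple_relations (x : 'M[C]_n.+1) : Uq_relations q p E F K x -> x = 0.
Proof.
have np : (n < p)%N by rewrite ltn_mod.
rewrite /Uq_relations /= !inE => /or4P[|||/or3P[]] /eqP->; apply/matrixP => a b.
- apply/eqP; rewrite [X in _ == X]mxE; apply: contraLR np => /simpleEX.
  by have := ltn_ord b; lia.
- apply/eqP; rewrite [X in _ == X]mxE; apply: contraLR np => /simpleFX.
  by have := ltn_ord a; lia.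
- by rewrite !mxE simpleKX exprz_q_X2p// subrr.
- rewrite mxE [X in _ + X]mxE [X in _ - X]mxE mul_simpleKi simpleK_mul !mxE.
  case: eqP => [ab|_]; last by rewrite !mulr0n !(mulr0, mul0r) subrr.
  have -> : wt i a = wt i b + 2 by rewrite /wt; lia.
  rewrite mulr1n (@expfzDr C q)// -!invr_expz.
  move: (expfz_neq0 (wt i b) q0) => w0.
  rewrite [X in X - _](_ : _ = q ^+ 2 * beta q i b) ?subrr//.
  by rewrite -[q ^ 2]/(q ^+ 2) mulrAC [X in X * _ * _]mulrC mulfK.
- rewrite mxE [X in _ + X]mxE [X in _ - X]mxE mul_simpleKi simpleK_mul !mxE.
  case: eqP => [ab|_]; last by rewrite !mulr0 mul0r subrr.
  have -> : wt i a = wt i b - 2 by rewrite /wt; lia.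
  rewrite !mulr1 (@expfzDr C q)// -!invr_expz.
  move: (expfz_neq0 (wt i b) q0) => w0.
  by rewrite mulrAC divff// mul1r subrr.
- rewrite mxE [X in _ + X]mxE mxE [X in _ + X - _]mxE simpleEF simpleFE.
  have KKi : (K - Ki) a b = (q ^ wt i a - q ^ (- wt i a)) *+ (a == b).
    by rewrite mxE [X in _ + X]mxE mxE simpleKi mulrnBl.
  by rewrite [((_ *: _) : 'M__) a b]mxE KKi -mulrnBl beta_succ_sub mulrnAr subrr mxE.
Qed.

Lemma simple_Cas : Cas q p E F K = (cas q i.+1%:Z)%:A.
Proof.
apply/matrixP => a b.
have KKi : (q *: K + q^-1 *: Ki) a b
    = (q ^ (wt i a + 1) + q ^ (- (wt i a + 1))) *+ (a == b).
  rewrite mxE [X in X + _]mxE [X in _ + X]mxE simpleKi [K a b]mxE.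
  rewrite !mulrnAr -!mulrnDl; move: (wt i a) => w.
  rewrite opprD !(@expfzDr C q)// expr1z exprN1.
  by rewrite [q * _]mulrC [q^-1 * _]mulrC.
rewrite /Cas mxE simpleFE [X in _ + X]mxE KKi !mxE mulrnAr -mulrnDl.
rewrite mulr_natr; congr (_ *+ _).
rewrite /beta -(cas_sub p2 q_prim).
have -> : i.+1%:Z - a%:Z *+ 2 = wt i a + 1 by rewrite /wt; lia.
by rewrite [_ ^- 2 * _]mulrC subrK.
Qed.

Lemma simpleK_delta a :
  K * delta_mx a a = q ^ wt i a *: (delta_mx a a : 'M[C]_n.+1).
Proof.
apply/matrixP => b c; rewrite simpleK_mul !mxE.
by case: (b =P a) => [->|]; rewrite ?mulr0.
Qed.

Lemma simple_wproj z :
  (forall a : 'I_n.+1, ~~ ((2 * p)%:Z %| z - wt i a)%Z) -> wproj q p K z = 0.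
Proof.
move=> za; rewrite -[LHS]mulr1 -[1]/(1%:M) mx1_sum_delta mulr_sumr big1// => a _.
rewrite (wproj_eigen p2 q_prim char_2p _ (simpleK_delta a)).
by rewrite (negbTE (za a)).
Qed.

Lemma simple_wproj_neq0 : wproj q p K (wt i 0) != 0.
Proof.
apply/eqP => w0.
have := wproj_eigen p2 q_prim char_2p (wt i 0) (simpleK_delta ord0).
rewrite w0 mul0r subrr dvdz0 => /matrixP/(_ ord0 ord0).
by rewrite !mxE eqxx => /esym/eqP; rewrite oner_eq0.
Qed.

Let rels := simple_relations.

Lemma simple_Cas_sub k :
  Cas q p E F K - (cas q k.+1%:Z)%:A = (cas q i.+1%:Z - cas q k.+1%:Z)%:A.
Proof. by rewrite simple_Cas scalerBl. Qed.

(** On X_i the element x is 0, so H(x) = 1 and the idempotent is the projection on the highest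
    weight. *)
Lemma simple_idem_neq0 : idem q p E F K i 0 != 0.
Proof.
rewrite /idem (pev_Hpol_idem p2 q_prim) ?simple_wproj_neq0//.
by rewrite rmorphXn /= horner_algX simple_Cas_sub subrr scale0r expr2 !mul0r.
Qed.

(** If the Casimir eigenvalues differ, (Cas - c_k)^2 is a nonzero scalar killing the idempotent; if
    they agree, the weight does not occur in X_i. *)
Lemma simple_idem_eq0 k l : (k < 2 * p)%N -> (l < sdim p k)%N -> i != k ->
  idem q p E F K k l = 0.
Proof.
move=> k2 lk ik; have [cik|cik] := eqVneq (cas q i.+1%:Z) (cas q k.+1%:Z).
  rewrite /idem simple_wproj ?mulr0// => a; apply: contra ik => dw.
  apply/eqP; rewrite dvdz_subC in dw.
  move/eqP: cik; rewrite (cas_eq p2 q_prim) => cik.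
  by have [] := linked_weights p0 i2 k2 (ltn_ord a) lk dw cik.
have := pevX2_idem p2 q_prim char_2p rels k l.
rewrite rmorphXn /= horner_algX simple_Cas_sub expr2 -mulrA -!scalerAl !mul1r.
rewrite scalerA => /eqP; rewrite scaler_eq0 mulf_eq0 orbb subr_eq0 (negbTE cik).
by move/eqP.
Qed.

End SimpleModules.

(** * Universal properties of free algebras and quotients *)

Section FreeAlgebra.
Variables (F : comNzRingType) (I : choiceType).

Lemma free_alg_ind (J : free_alg F I -> Prop) : J 1 ->
  (forall x y, J x -> J y -> J (x + y)) -> (forall c x, J x -> J (c *: x)) ->
  (forall i x, J x -> J (free_gen F i * x)) -> forall x, J x.
Proof.
move=> J1 JD JZ JM x.
have J0 : J 0 by rewrite -[0](scale0r 1); apply: JZ.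
have JU (m : free_monoid I) : J (mkmalgU m 1).
  case: m; elim=> [|i s IH].
    by have -> : FMonom [::] = mone :> free_monoid I by apply/val_inj; rewrite /= fm1.
  have -> : FMonom (i :: s) = mmul (fmu i) (FMonom s) :> free_monoid I.
    by apply/val_inj; rewrite /= fmM fmU.
  have := JM i _ IH; rewrite /free_gen.
  suff -> : (mkmalgU (fmu i) 1 : free_alg F I) * mkmalgU (FMonom s) 1
      = mkmalgU (mmul (fmu i) (FMonom s)) 1 by [].
  by rewrite [LHS]malgM_def fgmulUU mulr1.
rewrite [x]monalgE; elim/big_ind: _ => // m _.
suff -> : mkmalgU m (mcoeff m x) = mcoeff m x *: (mkmalgU m 1 : free_alg F I).
  exact: JZ.
by apply/malgP => k; rewrite mcoeffZ !mcoeffU mulrnAr mulr1.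
Qed.

Variables (B : algType F) (g : I -> B).

Let h (m : free_monoid I) : B := \prod_(i <- m) g i.

Fact free_lift_mmorphism : mmorphism h.
Proof. by split=> [x y|]; rewrite /h ?fmM ?big_cat// fm1 big_nil. Qed.

HB.instance Definition _ := isMultiplicative.Build (free_monoid I) B h
  free_lift_mmorphism.

Lemma free_alg_lift :
  exists rho : {lrmorphism free_alg F I -> B}, forall i, rho (free_gen F i) = g i.
Proof.
pose f0 (x : free_alg F I) : B := mmap (in_alg B) h x.
have fZ : scalable f0.
  by move=> c x; rewrite /f0 mmapZ /= -scalerAl mul1r.
have fM : monoid_morphism f0.
  have cA (c : F) (y : B) : GRing.comm (in_alg B c) y.
    by rewrite /GRing.comm /= -scalerAl -scalerAr mul1r mulr1.
  have [m1 m2] := @commr_mmap_is_multiplicative (free_monoid I) F B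
    (in_alg B) h (fun x m m' => cA _ _).
  by split.
have fB : zmod_morphism f0 by move=> x y; exact: mmapB.
pose fBi := GRing.isZmodMorphism.Build _ _ f0 fB.
pose fMi := GRing.isMonoidMorphism.Build _ _ f0 fM.
pose fZi := GRing.isScalable.Build _ _ _ _ f0 fZ.
pose f : {lrmorphism free_alg F I -> B} := HB.pack f0 fBi fMi fZi.
exists f => i; rewrite /= /f0 /free_gen mmapU /= scale1r mul1r /h fmU.
by rewrite big_seq1.
Qed.

End FreeAlgebra.

Lemma quot_alg_lift (F : comNzRingType) (A B : algType F) (S : set A)
    (S1 : 1 \notin gen_ideal S) (f : {lrmorphism A -> B}) :
  (forall x, S x -> f x = 0) ->
  exists rho : {lrmorphism quot_alg S1 -> B}, forall x, rho (quot_proj S1 x) = f x.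
Proof.
move=> fS.
have fI x : x \in gen_ideal S -> f x = 0.
  move/gen_idealP/(_ [set x | f x = 0]); apply => //; split => /=.
  - exact: rmorph0.
  - by move=> y z /= fy fz; rewrite rmorphB /= fy fz subr0.
  - by move=> a b y /= fy; rewrite 2!rmorphM /= fy mulr0 mul0r.
pose r0 (x : quot_alg S1) : B := f (quot_repr x).
have r0E x : r0 (quot_proj S1 x) = f x.
  apply/eqP; rewrite -subr_eq0 -rmorphB; apply/eqP/fI/quot_projP.
  exact: quot_reprK.
have rB : zmod_morphism r0.
  move=> x y; rewrite -[x]quot_reprK -[y]quot_reprK -raddfB !r0E.
  exact: raddfB.
have rM : monoid_morphism r0.
  split; first by rewrite -[1]/(quot_proj S1 1) r0E rmorph1.
  move=> x y; rewrite -[x]quot_reprK -[y]quot_reprK -rmorphM !r0E.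
  exact: rmorphM.
have rZ : scalable r0.
  move=> c x; rewrite -[x]quot_reprK -linearZ !r0E.
  exact: linearZ.
pose rBi := GRing.isZmodMorphism.Build _ _ r0 rB.
pose rMi := GRing.isMonoidMorphism.Build _ _ r0 rM.
pose rZi := GRing.isScalable.Build _ _ _ _ r0 rZ.
pose r : {lrmorphism quot_alg S1 -> B} := HB.pack r0 rBi rMi rZi.
by exists r.
Qed.

(** * Images of the relations and idempotents under morphisms *)

Section Transport.
Variables (C : fieldType) (q : C) (p : nat) (A B : algType C).
Variables (rho : {lrmorphism A -> B}) (E F K : A).

Lemma lrmorph_horner_alg (a : A) (g : {poly C}) :
  rho (horner_alg a g) = horner_alg (rho a) g.
Proof.
elim/poly_ind: g => [|g c IH]; first by rewrite !rmorph0.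
rewrite !rmorphD !rmorphM /= !horner_algX !horner_algC IH.
by rewrite linearZ /= rmorph1.
Qed.

Lemma lrmorph_idem i j :
  rho (idem q p E F K i j) = idem q p (rho E) (rho F) (rho K) i j.
Proof.
have rZ c x : rho (c *: x) = c *: rho x by exact: linearZ.
have rD x y : rho (x + y) = rho x + rho y by exact: rmorphD.
have rM x y : rho (x * y) = rho x * rho y by exact: rmorphM.
have rX x n : rho (x ^+ n) = rho x ^+ n by exact: rmorphXn.
rewrite /idem rM lrmorph_horner_alg rmorphB; congr (horner_alg (_ - _) _ * _).
- by rewrite /Cas /= !(rD, rM, rZ, rX).
- by rewrite /= rZ rmorph1.
rewrite /wproj rZ raddf_sum; congr (_ *: _); apply: eq_bigr => l _.
by rewrite /= rZ rX.
Qed.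

Lemma Uq_relations_lrmorph : Uq_relations q p (rho E) (rho F) (rho K)
  = [set rho x | x in Uq_relations q p E F K].
Proof.
pose rl (A : algType C) (E F K : A) : seq A := [:: E ^+ p; F ^+ p; K ^+ (2 * p) - 1;
  K * E * K ^+ (2 * p).-1 - q ^+ 2 *: E;
  K * F * K ^+ (2 * p).-1 - q ^- 2 *: F;
  E * F - F * E - (q - q^-1)^-1 *: (K - K ^+ (2 * p).-1)].
have rlE : rl B (rho E) (rho F) (rho K) = map rho (rl A E F K).
  have rZ c x : rho (c *: x) = c *: rho x by exact: linearZ.
  have rB x y : rho (x - y) = rho x - rho y by exact: rmorphB.
  have rM x y : rho (x * y) = rho x * rho y by exact: rmorphM.
  have rX x n : rho (x ^+ n) = rho x ^+ n by exact: rmorphXn.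
  by rewrite /rl /map !(rB, rM, rZ, rX) rmorph1.
apply/seteqP; split=> x; rewrite /Uq_relations.
  by rewrite -/(rl B _ _ _) rlE => /mapP[y yr ->]; exists y.
by case=> y yr <-; rewrite -/(rl B _ _ _) rlE; exact: map_f.
Qed.

End Transport.

(** * The restricted quantum group *)

Section RestrictedQuantumGroup.
Variables (C : fieldType) (q : C) (p : nat) (p2 : (2 <= p)%N).

Local Notation E := (Uq_E q p2).
Local Notation F := (Uq_F q p2).
Local Notation K := (Uq_K q p2).
Local Notation proj := (quot_proj (Uq_relations_proper q p2)).

Lemma Uq_rels x : Uq_relations q p E F K x -> x = 0.
Proof.
rewrite (Uq_relations_lrmorph q p proj) => -[y yr <-].
rewrite -[RHS](raddf0 proj); apply/quot_projP; rewrite subr0.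
exact: sub_gen_ideal.
Qed.

Lemma ord3_cases (i : 'I_3) : [\/ i = inord 0, i = inord 1 | i = inord 2].
Proof.
case: i => [[|[|[|//]]]] h; [apply: Or31|apply: Or32|apply: Or33];
  by apply/val_inj; rewrite /= inordK.
Qed.

Lemma Uq_gen (J : Uq q p2 -> Prop) : J 1 ->
  (forall x y, J x -> J y -> J (x + y)) -> (forall c x, J x -> J (c *: x)) ->
  (forall x, J x -> J (E * x)) -> (forall x, J x -> J (F * x)) ->
  (forall x, J x -> J (K * x)) -> forall x, J x.
Proof.
move=> J1 JD JZ JE JF JK x; rewrite -[x]quot_reprK.
move: (quot_repr x) => {x}; apply: free_alg_ind.
- exact: J1.
- by move=> x y Jx Jy; rewrite (raddfD proj); exact: JD.
- move=> c x Jx; have -> : proj (c *: x) = c *: proj x by exact: linearZ.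
  exact: JZ.
- move=> i x Jx; rewrite (rmorphM proj).
  by case: (ord3_cases i) => ->; [apply: JE | apply: JF | apply: JK].
Qed.

Lemma Uq_lift (B : algType C) (e f k : B) :
  (forall x, Uq_relations q p e f k x -> x = 0) ->
  exists rho : {lrmorphism Uq q p2 -> B}, [/\ rho E = e, rho F = f & rho K = k].
Proof.
move=> rels.
pose g (i : 'I_3) := if i == inord 0 then e else if i == inord 1 then f else k.
have [phi phiE] := free_alg_lift g.
have g0 : g (inord 0) = e by rewrite /g eqxx.
have g1 : g (inord 1) = f.
  by rewrite /g eqxx ifF//; apply/eqP => /(congr1 val); rewrite /= !inordK.
have g2 : g (inord 2) = k.
  by rewrite /g !ifF//; apply/eqP => /(congr1 val); rewrite /= !inordK.
have [x xr|rho rhoE] := quot_alg_lift (Uq_relations_proper q p2) (f := phi).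
  apply: rels; rewrite -g0 -g1 -g2 -!phiE Uq_relations_lrmorph.
  by exists x.
by exists rho; split; rewrite rhoE phiE.
Qed.

Hypotheses (q_prim : (2 * p).-primitive_root q).
Hypothesis char_2p : (2 * p)%:R != 0 :> C.

Lemma Uq_e_is_basic_set :
  is_basic_set [set x : Uq q p2 | exists (b : bool) (s : nat),
    (1 <= s <= p)%N /\ x = e_ q p E F K b s].
Proof.
apply: e_is_basic_set => //; [exact: Uq_rels | exact: Uq_gen |].
move=> i k l i2 k2 lk ik.
have [rho [rE rF rK]] := Uq_lift (simple_relations p2 q_prim char_2p i2).
have rhoI a b : rho (idem q p E F K a b)
    = idem q p (simpleE q p i) (simpleF C p i) (simpleK q p i) a b.
  by rewrite lrmorph_idem rE rF rK.
exists 'M[C]_((i %% p).+1)%N, rho; split.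
  apply/eqP => h; have := simple_idem_neq0 p2 q_prim char_2p i2.
  by rewrite -rhoI => /eqP; apply.
exact: etrans (rhoI k l) (simple_idem_eq0 p2 q_prim char_2p i2 k2 lk ik).
Qed.

End RestrictedQuantumGroup.

(** * The root of unity exp (pi i / p) *)

Section RootOfUnity.
Variable R : realType.

Lemma cis_exp (t : R) n :
  (cos t +i* sin t)%C ^+ n = (cos (t *+ n) +i* sin (t *+ n))%C.
Proof.
elim: n => [|n IH]; first by rewrite expr0 mulr0n cos0 sin0.
rewrite exprSr IH mulrSr cosD sinD; apply/eqP; rewrite eq_complex /=.
by rewrite eqxx addrC eqxx.
Qed.

(** An order m < 2p is impossible: the sine of m pi / p is positive for m < p and negative for m >
    p, and for m = p the cosine is -1. *)
Lemma q_root_prim p : (2 <= p)%N -> (2 * p).-primitive_root (q_root R p).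
Proof.
move=> p2; have pR0 : 0 < p%:R :> R by rewrite ltr0n ltnW.
set t : R := trigo.pi / p%:R.
have tp : t *+ p = trigo.pi by rewrite -mulr_natr divfK ?gt_eqF.
have t0 : 0 < t by rewrite divr_gt0// pi_gt0.
have q1 : q_root R p ^+ (2 * p) = 1.
  by rewrite cis_exp -/t mulnC mulrnA tp cos2pi sin2pi.
have [|m mq] := prim_order_exists _ q1; first by lia.
move=> m_dvd; have m2p : (m <= 2 * p)%N by apply: dvdn_leq m_dvd; lia.
suff -> : (2 * p)%N = m by [].
apply/eqP; rewrite eqn_leq m2p andbT leqNgt; apply/negP => m_lt.
have m0 := prim_order_gt0 mq.
have := prim_expr_order mq; rewrite cis_exp -/t => /eqP.
rewrite eq_complex /= => /andP[/eqP c1 /eqP s0].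
have [mp|] := ltnP m p.
  have : 0 < sin (t *+ m).
    by apply: sin_gt0_pi; rewrite pmulrn_lgt0// t0 -tp ltr_pMn2l.
  by rewrite s0 ltxx.
rewrite leq_eqVlt => /predU1P[pm|pm].
  by move: c1; rewrite -pm tp cospi => /eqP; rewrite eq_sym -subr_eq0 opprK
    (_ : 1 + 1 = 2%:R)// pnatr_eq0.
have : 0 < sin (t *+ (m - p)).
  apply: sin_gt0_pi; rewrite pmulrn_lgt0 ?subn_gt0// t0 -tp ltr_pMn2l//=.
  by lia.
move: s0; rewrite -{1}(subnK (ltnW pm)) mulrnDr tp sinDpi => /eqP.
by rewrite oppr_eq0 => /eqP ->; rewrite ltxx.
Qed.

End RootOfUnity.

Theorem theorem3p9 (R : realType) (p : nat) (p2 : (2 <= p)%N) :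
  let q : R[i] := q_root R p in
  is_basic_set
    [set x : Uq q p2 | exists (b : bool) (s : nat),
       (1 <= s <= p)%N /\ x = e_ q p (Uq_E q p2) (Uq_F q p2) (Uq_K q p2) b s].
Proof.
apply: Uq_e_is_basic_set; first exact: q_root_prim.
by rewrite pnatr_eq0 muln_eq0 /= -lt0n ltnW.
Qed.
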